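(* Let $\alpha>0$ and $M>0$. There is a constant $C>0$ depending only on $\alpha$ and $M$ such that for all integers $n\ge2$, $$C^{-1}r_n\le \inf_{\hat\theta}\ \sup_{f\in\mathcal{F}_\alpha(M)}\ \sup_{\mathbb{P}_\xi}\ \mathbb{E}\left\{\frac1{n^2}\sum_{i,j\in[n]}(\hat\theta_{ij}-\theta_{ij})^2\right\}\le C\,r_n,\qquad r_n=\begin{cases} n^{-\frac{2\alpha}{\alpha+1}}, & 0<\alpha<1,\\[4pt] \dfrac{\log n}{n}, & \alpha\ge1,\end{cases}$$ where the infimum is over all estimators $\hat\theta$ (measurable functions of the observed adjacency matrix $A$, with values in $\mathbb{R}^{n\times n}$), the second supremum is over all probability distributions $\mathbb{P}_\xi$ on $[0,1]^n$, and the expectation is jointly over $\{A_{ij}\}$ and $\{\xi_i\}$.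
   Context: Notation: $[m]=\{1,\dots,m\}$, $\lfloor\alpha\rfloor$ is the largest integer no greater than $\alpha$. Model: $(\xi_1,\dots,\xi_n)\sim\mathbb{P}_\xi$, an arbitrary distribution on $[0,1]^n$ (the $\xi_i$ are not observed). For $i\ne j$, $\theta_{ij}=f(\xi_i,\xi_j)$, and $\theta_{ii}=0$. Conditionally on $(\xi_1,\dots,\xi_n)$, the variables $A_{ij}=A_{ji}\sim\mathrm{Bernoulli}(\theta_{ij})$, $1\le j<i\le n$, are independent; $A_{ii}=0$. Only $A=\{A_{ij}\}$ is observed. Function class: let $\mathcal{D}=\{(x,y)\in[0,1]^2:x\ge y\}$, $\nabla_{jk}f(x,y)=\frac{\partial^{j+k}}{(\partial x)^j(\partial y)^k}f(x,y)$ with $\nabla_{00}f=f$, and $$\|f\|_{\mathcal{H}_\alpha}=\max_{j+k\le\lfloor\alpha\rfloor}\sup_{(x,y)\in\mathcal{D}}|\nabla_{jk}f(x,y)|+\max_{j+k=\lfloor\alpha\rfloor}\ \sup_{(x,y)\ne(x',y')\in\mathcal{D}}\frac{|\nabla_{jk}f(x,y)-\nabla_{jk}f(x',y')|}{(|x-x'|+|y-y'|)^{\alpha-\lfloor\alpha\rfloor}}.$$ $\mathcal{F}_\alpha(M)$ is the set of symmetric functions $f:[0,1]^2\to[0,1]$ ($f(x,y)=f(y,x)$) with $\|f\|_{\mathcal{H}_\alpha}\le M$ (only values on $\mathcal{D}$ enter the norm). *)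

(* Defs.v *)
From HB Require Import structures.
From mathcomp Require Import all_boot all_order all_algebra.
From mathcomp Require Import all_classical all_reals all_analysis.
Set Implicit Arguments.
Unset Strict Implicit.
Unset Printing Implicit Defensive.
Import Order.TTheory GRing.Theory Num.Theory.
Import numFieldNormedType.Exports.
Local Open Scope classical_set_scope.
Local Open Scope ring_scope.

Section HolderClass.
Variable R : realType.

Definition square : set (R * R) := [set p | 0 <= p.1 <= 1 /\ 0 <= p.2 <= 1].

Definition triangle : set (R * R) := [set p | square p /\ p.2 <= p.1].

(* Partial derivatives relative to the closed triangle: two-sided inside it,
   one-sided on its sides.  At (1, 1) for x, and at (0, 0) for y, the triangle
   contains no other point of the relevant line; the filter is then trivial
   and the derivative there is unconstrained by these two definitions. *)
Definition is_partial_x (g : R * R -> R) (p : R * R) (l : R) : Prop :=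
  h^-1 * (g (p.1 + h, p.2) - g p)
    @[h --> within [set h | triangle (p.1 + h, p.2)] 0^'] --> l.

Definition is_partial_y (g : R * R -> R) (p : R * R) (l : R) : Prop :=
  h^-1 * (g (p.1, p.2 + h) - g p)
    @[h --> within [set h | triangle (p.1, p.2 + h)] 0^'] --> l.

(* [D j k] is (d/dx)^j (d/dy)^k f on the triangle, for all j + k <= m. *)
Definition partials (m : nat) (f : R * R -> R) (D : nat -> nat -> R * R -> R)
    : Prop :=
  [/\ forall p, triangle p -> D 0%N 0%N p = f p,
      forall k p, (k < m)%N -> triangle p ->
        is_partial_y (D 0%N k) p (D 0%N k.+1 p)
    & forall j k p, (j + k < m)%N -> triangle p ->
        is_partial_x (D j k) p (D j.+1 k p)].

Definition sup_norm (g : R * R -> R) : \bar R :=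
  ereal_sup [set `|g p|%:E | p in triangle].

Definition holder_seminorm (s : R) (g : R * R -> R) : \bar R :=
  ereal_sup [set (`|g pq.1 - g pq.2| /
                  (`|pq.1.1 - pq.2.1| + `|pq.1.2 - pq.2.2|) `^ s)%:E
            | pq in [set pq : (R * R) * (R * R) |
                     [/\ triangle pq.1, triangle pq.2 & pq.1 <> pq.2]]].

(* The Hoelder norm of f, computed from its array [D] of partial derivatives;
   for a >= 0, [Num.truncn a] is the integer part of a. *)
Definition holder_norm (a : R) (D : nat -> nat -> R * R -> R) : \bar R :=
  let m := Num.truncn a in
  (\big[maxe/-oo]_(jk : 'I_m.+1 * 'I_m.+1 | (jk.1 + jk.2 <= m)%N)
      sup_norm (D jk.1 jk.2)
   + \big[maxe/-oo]_(jk : 'I_m.+1 * 'I_m.+1 | (jk.1 + jk.2 == m)%N)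
      holder_seminorm (a - m%:R) (D jk.1 jk.2))%E.

(* Only the values of f on [square] are constrained, and only these are used. *)
Definition holder_class (a M : R) : set (R * R -> R) :=
  [set f | [/\ forall p, square p -> 0 <= f p <= 1,
               forall p, square p -> f p = f (p.2, p.1)
             & exists D, partials (Num.truncn a) f D /\
                         (holder_norm a D <= M%:E)%E]].

End HolderClass.

Section GraphonModel.
Variables (R : realType) (n : nat).

Definition unit_cube : set (n.-tuple (measurableTypeR R)) :=
  [set xi | forall i, 0 <= (tnth xi i : R) <= 1].

Definition latent_law : set (probability (n.-tuple (measurableTypeR R)) R) :=
  [set P | P unit_cube = 1%E].

Definition edge_prob (f : R * R -> R) (xi : n.-tuple (measurableTypeR R))
    : 'M[R]_n :=
  \matrix_(i, j) if i == j then 0 else f (tnth xi i, tnth xi j).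

(* Law of A given theta: the entries below the diagonal are independent,
   A i j ~ Bernoulli (theta i j); A is symmetric with null diagonal. *)
Definition adjacency_pmf (theta : 'M[R]_n) (A : 'M[bool]_n) : R :=
  if (A^T == A) && [forall i, ~~ A i i] then
    \prod_(i < n) \prod_(j < n | (j < i)%N) bernoulli_pmf (theta i j) (A i j)
  else 0.

Definition loss (that theta : 'M[R]_n) : R :=
  (n%:R ^+ 2)^-1 * \sum_(i < n) \sum_(j < n) (that i j - theta i j) ^+ 2.

(* 'M[bool]_n is finite, so every map out of it is a measurable estimator. *)
Definition estimator := 'M[bool]_n -> 'M[R]_n.

(* Joint expectation over xi ~ P and A given xi.  Integrating over the cube,
   which has full measure, keeps the values of f off the square out of it. *)
Definition risk (that : estimator) (f : R * R -> R)
    (P : probability (n.-tuple (measurableTypeR R)) R) : \bar R :=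
  (\int[P]_(xi in unit_cube)
     (\sum_(A : 'M[bool]_n)
        adjacency_pmf (edge_prob f xi) A * loss (that A) (edge_prob f xi))%:E)%E.

Definition minimax_risk (a M : R) : \bar R :=
  ereal_inf [set ereal_sup [set ereal_sup [set risk that f P | P in latent_law]
                           | f in holder_class a M]
            | that in [set: estimator]].

End GraphonModel.

Definition rate (R : realType) (a : R) (n : nat) : R :=
  if a < 1 then n%:R `^ (- (2 * a / (a + 1))) else ln n%:R / n%:R.

(* Main.v *)
Require Import Defs.
From mathcomp Require Import all_boot all_order all_algebra.
From mathcomp Require Import all_classical all_reals all_analysis.
From mathcomp Require Import ring lra zify.
Set Implicit Arguments.
Unset Strict Implicit.
Unset Printing Implicit Defensive.
Import Order.TTheory GRing.Theory Num.Theory.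
Import numFieldNormedType.Exports.
Local Open Scope ring_scope.

(** The rate is the larger of two costs: estimating a function known to be
    [b]-Hoelder, [b = min alpha 1], which costs [n^(-2b/(b+1))], and finding
    the unknown positions of the nodes, which costs [ln n / n].  The first one
    dominates for [alpha < 1] and the second one otherwise
    ([rates_le_rate]); smoothness beyond 1 does not help, because positions
    cannot be estimated.

    Upper bound.  A function of the class is [b]-Hoelder on the whole square
    ([holder_class_modulus]): for [alpha >= 1] by the mean value theorem inside
    the triangle, and across the diagonal because reflecting points into the
    triangle contracts distances.  Hence, with [k] of the order of
    [n^(1/(1+b))], the matrix of edge probabilities is within [k^(-b)] of a
    block matrix with [k] classes of nodes, whose entries are multiples of
    [k^(-b)] that change by a bounded number of steps between neighbouring
    blocks ([net_approximation]).  There are [k^n] labellings and, thanks to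
    the bounded steps, only [exp (O (k^2))] tables, so that the logarithm of
    the size of this net is of the order of [n ln k + k^2].  Least squares over
    a finite family pays the squared bias and that logarithm
    ([least_squares_risk]), a consequence of the sub-Gaussian tails of Bernoulli
    variables and of a union bound.  Dividing by [n^2] gives the two costs.

    Lower bounds.  Point masses are admissible laws of the latent variables,
    so that it is enough to exhibit, for each estimator, one function and one
    configuration of nodes ([minimax_risk_ge]).  Both constructions index edge
    probabilities by a hypercube such that flipping a coordinate has bounded
    chi-square effect on the graph, and conclude by [assouad].

    For [alpha < 1] the nodes are placed on a grid and the coordinates switch
    bumps of height [k^(-alpha)] on and off.  A bump is seen by about [(n/k)^2]
    edges, too few to detect it.

    For [alpha >= 1] the function is the fixed wave [c + h cos (w x y)] and the
    coordinates are bits of the positions of half of the nodes.  The other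
    nodes sit at heights [y] at which the wave reads one digit of [x]; there are
    about [ln n] digits, so that [n / ln n] nodes read each of them and
    [h = (ln n / n)^(1/2)] is not detectable.  The frequency [w] is a
    small power of [n], hence the wave, of amplitude close to [n^(-1/2)],
    remains in the Hoelder ball whatever [alpha] is.  Each position has about
    [ln n] bits that cannot be read, and each of them costs [h^2 n / ln n], that
    is, a constant: in total [n ln n] out of [n^2]. *)

(** * Random graphs with independent edges *)

(** Below the diagonal, each unordered pair of nodes is listed once. *)
Definition lower n : pred ('I_n * 'I_n) := fun p => (p.2 < p.1)%N.

Lemma adjacency_pmfE (R : realType) n (theta : 'M[R]_n) (A : 'M[bool]_n) :
  adjacency_pmf theta A =
  if (A^T == A) && [forall i, ~~ A i i] then
    \prod_(p | lower p) bernoulli_pmf (theta p.1 p.2) (A p.1 p.2)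
  else 0.
Proof. by rewrite /adjacency_pmf pair_big_dep. Qed.

(** An undirected graph is a free choice of its entries below the diagonal,
    so that a sum of products over graphs is a product of sums over entries. *)
Lemma sum_graphs_prod (R : realType) n (g : 'I_n * 'I_n -> bool -> R) :
  \sum_(A : 'M[bool]_n | (A^T == A) && [forall i, ~~ A i i])
     \prod_(p | lower p) g p (A p.1 p.2)
  = \prod_(p | lower p) (g p true + g p false).
Proof.
under [RHS]eq_bigr => p _ do rewrite -big_bool.
rewrite (big_distr_big false (@lower n) xpredT) /=.
pose low (A : 'M[bool]_n) := [ffun p => lower p && A p.1 p.2].
pose sym (s : {ffun 'I_n * 'I_n -> bool}) : 'M[bool]_n :=
  \matrix_(i, j) if (j < i)%N then s (i, j) else (i < j)%N && s (j, i).
rewrite [RHS](reindex_onto low sym) /=.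
  apply: eq_big => [A|A _].
    apply/andP/andP => [[/eqP sA /forallP dA]|[_ /eqP <-]]; split.
    - apply/pffun_onP; split=> //.
      by apply/supportP => p /negbTE pl; rewrite ffunE; move: pl; rewrite /in_mem /= => ->.
    - apply/eqP/matrixP => i j; rewrite mxE !ffunE /lower /=.
      case: ltngtP => //= ij; last by apply/esym/negbTE; rewrite (val_inj ij) dA.
      by rewrite -[in RHS]sA mxE.
    - apply/eqP/matrixP => i j; rewrite !mxE; by case: ltngtP.
    - by apply/forallP => i; rewrite mxE ltnn.
  by apply: eq_bigr => p lp; rewrite ffunE lp.
move=> s /pffun_onP[/supportP s0 _]; apply/ffunP => -[i j]; rewrite ffunE /lower /=.
have [ij|ij] := boolP (j < i)%N; first by rewrite mxE ij.
by rewrite s0 // /in_mem /= /lower /= (negbTE ij).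
Qed.

(** Functions of distinct entries are independent.  Exponential moments and
    chi-square divergences are both means of such products. *)
Lemma adjacency_pmf_prod (R : realType) n (theta : 'M[R]_n)
    (w : 'I_n * 'I_n -> bool -> R) :
  \sum_(A : 'M[bool]_n) adjacency_pmf theta A *
     \prod_(p | lower p) w p (A p.1 p.2)
  = \prod_(p | lower p) (theta p.1 p.2 * w p true +
                         (1 - theta p.1 p.2) * w p false).
Proof.
rewrite -(sum_graphs_prod (fun p b => bernoulli_pmf (theta p.1 p.2) b * w p b)).
rewrite [RHS]big_mkcond /=; apply: eq_bigr => A _; rewrite adjacency_pmfE.
by case: ifP => _; rewrite ?mul0r // -big_split.
Qed.

Lemma adjacency_pmf_sum1 (R : realType) n (theta : 'M[R]_n) :
  \sum_(A : 'M[bool]_n) adjacency_pmf theta A = 1.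
Proof.
have := adjacency_pmf_prod theta (fun _ _ => 1).
rewrite [RHS]big1 => [<-|p _]; last by rewrite !mulr1 addrC subrK.
by apply: eq_bigr => A _; rewrite big1_eq mulr1.
Qed.

Lemma adjacency_pmf_ge0 (R : realType) n (theta : 'M[R]_n) A :
  (forall i j, 0 <= theta i j <= 1) -> 0 <= adjacency_pmf theta A.
Proof.
move=> th01; rewrite adjacency_pmfE; case: ifP => // _.
by apply: prodr_ge0 => p _; apply: bernoulli_pmf_ge0.
Qed.

(** Each unordered pair is counted once, whereas [loss] counts it twice. *)
Definition sqdist (R : realType) n (a b : 'M[R]_n) : R :=
  \sum_(p | lower p) (a p.1 p.2 - b p.1 p.2) ^+ 2.

Lemma loss_sqdist (R : realType) n (a b : 'M[R]_n) :
  (forall i j, a i j = a j i) -> (forall i j, b i j = b j i) ->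
  (forall i, a i i = b i i) ->
  loss a b = (n%:R ^+ 2)^-1 * (2 * sqdist a b).
Proof.
move=> sa sb dab; rewrite /loss; congr (_ * _).
rewrite pair_bigA /= (bigID (@lower n)) /= mulr2n mulrDl mul1r; congr (_ + _).
rewrite (bigID (fun p => lower (p.2, p.1))) /= [X in _ + X]big1 ?addr0.
  rewrite (reindex_inj (h := fun p => (p.2, p.1))) /=; last by move=> [? ?] [? ?] [-> ->].
  apply: eq_big => [[i j]|[i j] _] /=; first by rewrite /lower /=; case: ltngtP.
  by rewrite sa sb.
move=> [i j]; rewrite /lower /=; case: ltngtP => //= /val_inj -> _.
by rewrite dab subrr expr0n.
Qed.

Lemma loss_ge (R : realType) n (a b : 'M[R]_n) :
  (n%:R ^+ 2)^-1 * sqdist a b <= loss a b.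
Proof.
apply: ler_wpM2l; first by rewrite invr_ge0 exprn_ge0.
by rewrite pair_bigA /= (bigID (@lower n)) /= lerDl sumr_ge0 // => p _; apply: sqr_ge0.
Qed.

Lemma loss_ge0 (R : realType) n (a b : 'M[R]_n) : 0 <= loss a b.
Proof.
apply: mulr_ge0; first by rewrite invr_ge0 exprn_ge0.
by do 2!(apply: sumr_ge0 => ? _); apply: sqr_ge0.
Qed.

(** The integrand of [risk]: given the latent variables, only the matrix of
    edge probabilities matters. *)
Definition matrix_risk (R : realType) n (that : estimator R n) (theta : 'M[R]_n) : R :=
  \sum_(A : 'M[bool]_n) adjacency_pmf theta A * loss (that A) theta.

(** * Assouad's lemma for random graphs *)

(** With [b = a * l], minimizing [a * u ^+ 2 + b * v ^+ 2] at fixed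
    [u - v] gives the harmonic mean of the weights; the right-hand side is its
    tangent parabola at [a = b], which stays integrable against the square of a likelihood ratio. *)
Lemma two_point_tangent (R : realFieldType) (a l u v : R) :
  0 <= a -> 0 <= l ->
  (u - v) ^+ 2 * (3 / 4 * (a * l) - (a * l * l) / 4) <= a * u ^+ 2 + a * l * v ^+ 2.
Proof.
move=> a0 l0; rewrite -subr_ge0.
have l1 : 0 < 1 + l by rewrite ltr_wpDr.
have -> : a * u ^+ 2 + a * l * v ^+ 2 -
    (u - v) ^+ 2 * (3 / 4 * (a * l) - (a * l * l) / 4) =
  a / (1 + l) * ((u + l * v) ^+ 2 + (u - v) ^+ 2 * (l / 4 * (1 - l) ^+ 2)).
  by field; rewrite gt_eqF.
apply: mulr_ge0; first by rewrite divr_ge0 // ltW.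
apply: addr_ge0; first exact: sqr_ge0.
apply: mulr_ge0; first exact: sqr_ge0.
by apply: mulr_ge0; [apply: divr_ge0 | apply: sqr_ge0].
Qed.

Lemma expR_half_le2 (R : realType) : expR (1 / 2) <= 2 :> R.
Proof.
have := expR_ge1Dx (- (1 / 2) : R); rewrite expRN => h.
have e0 := expR_gt0 (1 / 2 : R).
rewrite -(ler_pM2r (x := (expR (1/2))^-1)) ?invr_gt0 // divff ?gt_eqF //; lra.
Qed.

(** The chi-square divergence between two inhomogeneous random graphs is a
    product over their entries, hence controlled by [sqdist]. *)
Lemma likelihood_ratio_bound (R : realType) n (v : R) (th0 th1 : 'M[R]_n) :
  0 < v -> (forall p, lower p -> 0 < th0 p.1 p.2 < 1 /\ v <= th0 p.1 p.2 * (1 - th0 p.1 p.2)) ->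
  sqdist th0 th1 <= v / 2 ->
  \prod_(p | lower p)
     (th1 p.1 p.2 * (th1 p.1 p.2 / th0 p.1 p.2) +
      (1 - th1 p.1 p.2) * ((1 - th1 p.1 p.2) / (1 - th0 p.1 p.2))) <= 2.
Proof.
move=> v0 hv hd; apply: le_trans (expR_half_le2 R).
apply: (@le_trans _ _ (expR (\sum_(p | lower p) (th0 p.1 p.2 - th1 p.1 p.2) ^+ 2 / v))).
  rewrite expR_sum; apply: ler_prod => p lp.
  have [/andP[t0 t1] tv] := hv p lp.
  set x := th0 _ _ in t0 t1 tv *; set y := th1 _ _.
  have x1 : 0 < 1 - x by rewrite subr_gt0.
  have -> : y * (y / x) + (1 - y) * ((1 - y) / (1 - x)) =
            1 + (x - y) ^+ 2 / (x * (1 - x)).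
    by field; rewrite !gt_eqF.
  apply/andP; split; first by rewrite addr_ge0 // divr_ge0 ?sqr_ge0 // mulr_ge0 ?ltW.
  apply: le_trans (expR_ge1Dx _); rewrite lerD2l.
  apply: ler_wpM2l; first exact: sqr_ge0.
  by rewrite lef_pV2 // posrE // mulr_gt0.
rewrite ler_expR -mulr_suml ler_pdivrMr //; move: hd; rewrite /sqdist; lra.
Qed.

(** Le Cam's two-point bound: hypotheses with bounded likelihood ratio in
    mean square cannot both be estimated better than their separation. *)
Lemma two_point_risk (R : realType) n (v : R) (th0 th1 : 'M[R]_n)
    (u : 'M[bool]_n -> R) (a0 a1 : R) :
  0 < v -> (forall p, lower p -> 0 < th0 p.1 p.2 < 1 /\ v <= th0 p.1 p.2 * (1 - th0 p.1 p.2)) ->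
  (forall i j, 0 <= th0 i j <= 1) -> (forall i j, 0 <= th1 i j <= 1) ->
  sqdist th0 th1 <= v / 2 ->
  (a0 - a1) ^+ 2 / 4 <=
    \sum_(A : 'M[bool]_n) adjacency_pmf th0 A * (u A - a0) ^+ 2 +
    \sum_(A : 'M[bool]_n) adjacency_pmf th1 A * (u A - a1) ^+ 2.
Proof.
move=> v0 h0 h00 h1 hd.
pose w (p : 'I_n * 'I_n) b :=
  bernoulli_pmf (th1 p.1 p.2) b / bernoulli_pmf (th0 p.1 p.2) b.
pose L (A : 'M[bool]_n) := \prod_(p | lower p) w p (A p.1 p.2).
have b0 p b : lower p -> 0 < bernoulli_pmf (th0 p.1 p.2) b.
  by move=> /h0[/andP[? ?] _]; case: b; rewrite /= ?subr_gt0.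
have PL A : adjacency_pmf th1 A = adjacency_pmf th0 A * L A.
  rewrite !adjacency_pmfE; case: ifP => _; last by rewrite mul0r.
  rewrite -big_split /=; apply: eq_bigr => p lp; rewrite /w mulrC divfK //.
  by rewrite gt_eqF // b0.
have E1 : \sum_A adjacency_pmf th1 A = 1 := adjacency_pmf_sum1 th1.
have E2 : \sum_A adjacency_pmf th1 A * L A <= 2.
  by rewrite adjacency_pmf_prod; apply: likelihood_ratio_bound hd.
rewrite -big_split /=.
apply: (@le_trans _ _ (\sum_A (a0 - a1) ^+ 2 *
   (3 / 4 * adjacency_pmf th1 A - (adjacency_pmf th1 A * L A) / 4))).
  rewrite -mulr_sumr big_split /= -mulr_sumr E1 sumrN -mulr_suml.
  by apply: ler_wpM2l; [apply: sqr_ge0 | lra].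
apply: ler_sum => A _; rewrite PL.
have -> : (a0 - a1) ^+ 2 = ((u A - a0) - (u A - a1)) ^+ 2 by ring.
apply: two_point_tangent.
  exact: adjacency_pmf_ge0.
apply: prodr_ge0 => p lp; apply: divr_ge0; last exact/ltW/b0.
by apply: bernoulli_pmf_ge0.
Qed.

Definition flip (I : finType) (i : I) (z : {ffun I -> bool}) : {ffun I -> bool} :=
  [ffun x => if x == i then ~~ z x else z x].

Lemma flipK (I : finType) (i : I) : involutive (flip i).
Proof. by move=> z; apply/ffunP => x; rewrite !ffunE; case: eqP => // _; rewrite negbK. Qed.

(** In both lower bounds the unknown information is placed on this bipartite
    part of the graph; the edges inside either half carry none. *)
Definition crossing n : pred ('I_n * 'I_n) := fun p => (p.2 < n./2 <= p.1)%N.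

Lemma crossing_lower n p : @crossing n p -> lower p.
Proof. by move=> /andP[h1 h2]; apply: leq_trans h1 h2. Qed.

Lemma card_crossing n : (2 <= n)%N -> (n ^ 2 <= 8 * #|@crossing n|)%N.
Proof.
move=> n2.
have -> : #|@crossing n| = (#|[pred i : 'I_n | (n./2 <= i)%N]| * #|[pred j : 'I_n | (j < n./2)%N]|)%N.
  by rewrite -cardX; apply: eq_card => -[i j]; rewrite !inE /crossing /in_mem /= andbC.
have c1 : #|[pred j : 'I_n | (j < n./2)%N]| = n./2.
  have hn : (n./2 <= n)%N by have := odd_double_half n; lia.
  by rewrite -sum1_card -(big_ord_widen n (fun _ => 1%N) hn) sum1_card card_ord.
have := cardC [pred j : 'I_n | (j < n./2)%N]; rewrite c1 card_ord.
have -> : #|[predC [pred j : 'I_n | (j < n./2)%N]]| = #|[pred i : 'I_n | (n./2 <= i)%N]|.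
  by apply: eq_card => i; rewrite !inE -leqNgt.
move=> h; set c := #|_| in h *.
have hn := odd_double_half n; set m := n./2 in h hn *.
have -> : c = (odd n + m)%N by lia.
by rewrite -{1}hn; case: (odd n); lia.
Qed.

(** Assouad's lemma for the squared loss: each coordinate of the cube is a
    two-point problem between neighbouring vertices, and the errors of these
    problems add up because they are measured on disjoint sets of entries. *)
Lemma assouad (R : realType) n (I : finType) (theta : {ffun I -> bool} -> 'M[R]_n)
    (cell : 'I_n * 'I_n -> I) (v d : R) (that : estimator R n) :
  (2 <= n)%N -> 0 < v -> 0 <= d ->
  (forall z i j, 0 <= theta z i j <= 1) ->
  (forall z p, lower p ->
     0 < theta z p.1 p.2 < 1 /\ v <= theta z p.1 p.2 * (1 - theta z p.1 p.2)) ->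
  (forall z i, sqdist (theta z) (theta (flip i z)) <= v / 2) ->
  (forall z p, crossing p ->
     d <= (theta z p.1 p.2 - theta (flip (cell p) z) p.1 p.2) ^+ 2) ->
  exists z, d / 64 <= matrix_risk that (theta z).
Proof.
move=> n2 v0 d0 h01 hv hflip hsep; apply: contrapT => /forallNP H.
have Hlt z : matrix_risk that (theta z) < d / 64 by rewrite ltNge; apply/negP/H.
pose E z p := \sum_(A : 'M[bool]_n) adjacency_pmf (theta z) A *
                (that A p.1 p.2 - theta z p.1 p.2) ^+ 2.
have n0 : 0 < (n%:R ^+ 2 : R) by rewrite exprn_gt0 // ltr0n; lia.
have Ege z : (n%:R ^+ 2)^-1 * \sum_(p | crossing p) E z p <= matrix_risk that (theta z).
  rewrite /E exchange_big /= mulr_sumr; apply: ler_sum => A _.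
  rewrite -mulr_sumr mulrCA; apply: ler_wpM2l; first exact: adjacency_pmf_ge0.
  apply: le_trans (loss_ge _ _); apply: ler_wpM2l; first by rewrite invr_ge0 ltW.
  rewrite /sqdist [leRHS](bigID (@crossing n)) /=.
  rewrite [X in _ <= X + _](eq_bigl (@crossing n)); last first.
    by move=> p; case: (boolP (crossing p)) => [/crossing_lower ->|]; rewrite ?andbF.
  by rewrite lerDl sumr_ge0 // => p _; apply: sqr_ge0.
have Esum p : crossing p -> #|{ffun I -> bool}|%:R * (d / 8) <= \sum_z E z p.
  move=> cp.
  (* Flipping the coordinate of [p] pairs the vertices of the cube. *)
  have -> : \sum_z E z p = (\sum_z (E z p + E (flip (cell p) z) p)) / 2.
    rewrite big_split /= -[X in _ = (_ + X) / 2](_ : \sum_z E z p = _); last first.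
      by rewrite [LHS](reindex_inj (can_inj (flipK (cell p)))).
    by field.
  rewrite ler_pdivlMr // -mulrA [_ / 8 * 2](_ : _ = d / 4); last by field.
  rewrite mulr_natl -sumr_const; apply: ler_sum => z _.
  apply: (le_trans _ (two_point_risk (fun A => that A p.1 p.2) _ _ v0 (hv z) (h01 _) (h01 _) (hflip z (cell p)))).
    by apply: ler_wpM2r => //; exact: hsep.
suff : \sum_z matrix_risk that (theta z) < \sum_z matrix_risk that (theta z) by rewrite ltxx.
apply: (@lt_le_trans _ _ (\sum_(z : {ffun I -> bool}) d / 64)).
  apply: ltr_sum => //; by apply/hasP; exists [ffun=> false]; rewrite ?mem_index_enum.
apply: (le_trans _ (ler_sum _ (fun z _ => Ege z))).
rewrite -[leRHS]mulr_sumr exchange_big /=.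
apply: (le_trans _ (ler_wpM2l _ (ler_sum _ Esum))); last by rewrite invr_ge0 ltW.
rewrite !sumr_const ler_pdivlMl //.
have /(_ R) := @ler_nat _ (n ^ 2) (8 * #|@crossing n|); rewrite (card_crossing n2) natrX natrM => hc.
rewrite -[X in _ * X <= _]mulr_natl -[X in _ <= X]mulr_natl.
have : 0 <= #|{ffun I -> bool}|%:R :> R by [].
move: #|{ffun I -> bool}|%:R (#|@crossing n|%:R : R) (n%:R ^+ 2 : R) hc => N c m hc N0.
have : N * d * m <= N * d * (8 * c) by apply: ler_wpM2l => //; apply: mulr_ge0.
lra.
Qed.

(** * Least squares over a finite family *)

Lemma expR_le_quadratic (R : realType) (x : R) :
  `|x| <= 1 / 2 -> expR x <= 1 + x + 2 * x ^+ 2.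
Proof.
rewrite ler_norml => /andP[h1 h2]; have := expR_ge1Dx (- x); rewrite expRN => h.
have e0 := expR_gt0 x; have hx : 0 < 1 - x by lra.
have : expR x * (1 - x) <= 1.
  by have := ler_wpM2l (ltW e0) h; rewrite divff // gt_eqF.
have : 1 <= (1 + x + 2 * x ^+ 2) * (1 - x).
  have := sqr_ge0 x; nra.
by move=> a b; have := le_trans b a; rewrite ler_pM2r.
Qed.

(** A centred Bernoulli variable is sub-Gaussian; only small arguments are
    used, since the entries of two candidate matrices differ by at most 1. *)
Lemma bernoulli_mgf (R : realType) (t s : R) :
  0 <= t <= 1 -> `|s| <= 1 / 2 ->
  t * expR (s * (1 - t)) + (1 - t) * expR (s * (0 - t)) <= expR (2 * s ^+ 2).
Proof.
move=> /andP[t0 t1] hs; apply: le_trans (expR_ge1Dx _).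
have b1 : `|s * (1 - t)| <= 1 / 2.
  rewrite normrM -[leRHS]mulr1; apply: ler_pM => //.
  by rewrite ger0_norm; lra.
have b2 : `|s * (0 - t)| <= 1 / 2.
  rewrite normrM -[leRHS]mulr1; apply: ler_pM => //.
  by rewrite sub0r normrN ger0_norm; lra.
have h1 := ler_wpM2l t0 (expR_le_quadratic b1).
have t1' : 0 <= 1 - t by lra.
have h2 := ler_wpM2l t1' (expR_le_quadratic b2).
apply: le_trans (lerD h1 h2) _.
have -> : t * (1 + s * (1 - t) + 2 * (s * (1 - t)) ^+ 2) +
  (1 - t) * (1 + s * (0 - t) + 2 * (s * (0 - t)) ^+ 2) =
  1 + 2 * s ^+ 2 * (t * (1 - t)) by ring.
rewrite lerD2l -[leRHS]mulr1; apply: ler_wpM2l; last by nra.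
by apply: mulr_ge0 => //; apply: sqr_ge0.
Qed.

(** The excess of the fit of [b] over that of [c] is a difference of biases
    plus a noise that is linear in the data; the penalty makes an exponential
    moment of this noise at most 1, and is absorbed by the error of the
    estimator. *)
Definition penalized_noise (R : realType) n (theta b c : 'M[R]_n) (A : 'M[bool]_n) : R :=
  \sum_(p | lower p) (2 * (b p.1 p.2 - c p.1 p.2) * ((A p.1 p.2)%:R - theta p.1 p.2)
                      - (b p.1 p.2 - c p.1 p.2) ^+ 2 / 4).

Lemma penalized_noise_mgf (R : realType) n (theta b c : 'M[R]_n) :
  (forall i j, 0 <= theta i j <= 1) -> (forall i j, 0 <= b i j <= 1) ->
  (forall i j, 0 <= c i j <= 1) ->
  \sum_(A : 'M[bool]_n)
     adjacency_pmf theta A * expR (penalized_noise theta b c A / 32) <= 1.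
Proof.
move=> h01 hb hc.
(* The factor 1 / 32 keeps the argument of [bernoulli_mgf] small and makes its
   bound cancel against the penalty. *)
pose u p := b p.1 p.2 - c p.1 p.2.
pose w p (x : bool) :=
  expR ((2 * u p * (x%:R - theta p.1 p.2) - u p ^+ 2 / 4) / 32).
under eq_bigr => A _ do rewrite /penalized_noise mulr_suml expR_sum.
rewrite (adjacency_pmf_prod theta w); apply: prodr_ile1 => p _.
have [/andP[b0 b1] /andP[c0 c1]] := (hb p.1 p.2, hc p.1 p.2).
have t01 := h01 p.1 p.2; have /andP[t0 t1] := t01.
have us : `|u p / 16| <= 1 / 2.
  by rewrite ler_norml /u; apply/andP; split; lra.
apply/andP; split.
  by apply: addr_ge0; apply: mulr_ge0; rewrite ?expR_ge0 // subr_ge0.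
have -> : theta p.1 p.2 * w p true + (1 - theta p.1 p.2) * w p false =
    expR (- (2 * (u p / 16) ^+ 2)) *
    (theta p.1 p.2 * expR (u p / 16 * (1 - theta p.1 p.2)) +
     (1 - theta p.1 p.2) * expR (u p / 16 * (0 - theta p.1 p.2))).
  rewrite mulrDr !(mulrCA (expR _)) -!expRD /w /=.
  by congr (_ * expR _ + _ * expR _); field.
by rewrite expRN ler_pdivrMl ?expR_gt0 // mulr1; apply: bernoulli_mgf.
Qed.

(** Jensen's inequality for the exponential, from its tangent at [ln N]. *)
Lemma mean_le_ln_mgf (R : realType) (T : finType) (P Z : T -> R) (N : R) :
  (forall x, 0 <= P x) -> \sum_x P x = 1 -> 0 < N ->
  \sum_x P x * expR (Z x) <= N -> \sum_x P x * Z x <= ln N.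
Proof.
move=> P0 P1 N0 hN; rewrite -subr_le0.
have -> : \sum_x P x * Z x - ln N = \sum_x P x * (Z x - ln N).
  by under [RHS]eq_bigr => x _ do rewrite mulrBr; rewrite sumrB -mulr_suml P1 mul1r.
apply: (@le_trans _ _ (\sum_x P x * (expR (Z x) / N - 1))).
  apply: ler_sum => x _; apply: ler_wpM2l => //.
  rewrite -[X in _ / X](lnK N0) -expRB.
  by have := expR_ge1Dx (Z x - ln N); lra.
under eq_bigr => x _ do rewrite mulrBr mulr1 mulrA.
by rewrite sumrB -mulr_suml P1 subr_le0 ler_pdivrMr // mul1r.
Qed.

Definition least_squares (R : realType) n (W : finType) (w0 : W)
    (t : W -> 'M[R]_n) : estimator R n :=
  fun A => t [arg min_(w < w0) sqdist (map_mx (fun b : bool => b%:R) A) (t w)]%O.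

(** Oracle inequality: up to constants the estimator pays the approximation
    error of any fixed candidate [w], and the logarithm of their number.  The
    noise is handled uniformly over the family by summing its exponential
    moments. *)
Lemma least_squares_risk (R : realType) n (W : finType) (w0 w : W)
    (t : W -> 'M[R]_n) (theta : 'M[R]_n) :
  (forall i j, 0 <= theta i j <= 1) -> (forall w i j, 0 <= t w i j <= 1) ->
  \sum_(A : 'M[bool]_n) adjacency_pmf theta A * sqdist (least_squares w0 t A) theta
  <= 3 * sqdist (t w) theta + 64 * ln #|W|%:R.
Proof.
move=> h01 ht.
have W0 : (0 < #|W|)%N by apply/card_gt0P; exists w0.
pose Z A := penalized_noise theta (least_squares w0 t A) (t w) A.
have hZ A : sqdist (least_squares w0 t A) theta <= 3 * sqdist (t w) theta + 2 * Z A.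
  rewrite /Z /least_squares; case: arg_minP => // w' _ /(_ w erefl).
  rewrite /sqdist /penalized_noise => hmin; rewrite -subr_ge0.
  rewrite !mulr_sumr -big_split /= -sumrB.
  have : 0 <= 2 * (\sum_(p | lower p) ((map_mx (fun b : bool => b%:R) A p.1 p.2 : R) - t w p.1 p.2) ^+ 2 -
     \sum_(p | lower p) (map_mx (fun b : bool => b%:R) A p.1 p.2 - t w' p.1 p.2) ^+ 2).
    by rewrite mulr_ge0 // subr_ge0.
  move=> /le_trans; apply; rewrite -sumrB mulr_sumr; apply: ler_sum => p _.
  rewrite mxE; set x := t w' _ _; set y := t w _ _; set th := theta _ _; set a := _%:R.
  have := sqr_ge0 ((y - th) + (x - th)); nra.
have P0 A : 0 <= adjacency_pmf theta A := adjacency_pmf_ge0 A h01.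
have mZ : \sum_A adjacency_pmf theta A * (Z A / 32) <= ln #|W|%:R.
  apply: mean_le_ln_mgf => //; first exact: adjacency_pmf_sum1.
    by rewrite ltr0n.
  apply: (@le_trans _ _ (\sum_(w' : W) \sum_A adjacency_pmf theta A *
     expR (penalized_noise theta (t w') (t w) A / 32))).
    rewrite exchange_big /=; apply: ler_sum => A _; rewrite -mulr_sumr.
    apply: ler_wpM2l => //; rewrite /Z /least_squares.
    set w' := (X in t X); rewrite (bigD1 w') //= lerDl.
    by apply: sumr_ge0 => ? _; apply: expR_ge0.
  rewrite -sum1_card natr_sum; apply: ler_sum => w' _.
  exact: penalized_noise_mgf.
apply: (@le_trans _ _ (\sum_A adjacency_pmf theta A * (3 * sqdist (t w) theta + 2 * Z A))).
  by apply: ler_sum => A _; apply: ler_wpM2l.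
under eq_bigr => A _ do rewrite mulrDr.
rewrite big_split /= -mulr_suml adjacency_pmf_sum1 mul1r lerD2l.
have -> : \sum_A adjacency_pmf theta A * (2 * Z A) = 64 * \sum_A adjacency_pmf theta A * (Z A / 32).
  by rewrite mulr_sumr; apply: eq_bigr => A _; field.
by rewrite ler_pM2l.
Qed.

(** * From the minimax risk to fixed positions of the nodes *)

Local Open Scope classical_set_scope.
Import HBNNSimple.

(** The supremum over simple minorants is monotone; the integrand of the risk
    depends on an arbitrary [f], so that measurability is best avoided. *)
Lemma ge0_le_integral_subfun d (T : measurableType d) (R : realType)
    (mu : {measure set T -> \bar R}) (D : set T) (f1 f2 : T -> \bar R) :
  (forall x, D x -> (0 <= f1 x)%E) -> (forall x, D x -> (f1 x <= f2 x)%E) ->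
  (\int[mu]_(x in D) f1 x <= \int[mu]_(x in D) f2 x)%E.
Proof.
move=> f10 f12; have f20 x : D x -> (0 <= f2 x)%E.
  by move=> Dx; apply: le_trans (f12 x Dx); apply: f10.
rewrite !ge0_integralE //; apply: ereal_sup_le => _ [h /= hf <-].
exists h => //= x; apply: le_trans (hf x) _.
exact: lee_restrict.
Qed.

Lemma measurable_tuple_box (R : realType) n (B : 'I_n -> set (measurableTypeR R)) :
  (forall i, measurable (B i)) ->
  measurable [set xi : n.-tuple (measurableTypeR R) | forall i, B i (tnth xi i)].
Proof.
move=> mB.
have -> : [set xi : n.-tuple (measurableTypeR R) | forall i, B i (tnth xi i)] =
    \bigcap_(i in [set: 'I_n]) ((fun xi : n.-tuple (measurableTypeR R) => tnth xi i) @^-1` B i).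
  by apply/seteqP; split => xi /= h i; [move=> _; exact: h | exact: (h i Logic.I)].
apply: fin_bigcap_measurable => // i _; rewrite -[X in measurable X]setTI.
exact: measurable_tnth.
Qed.

Lemma measurable_unit_cube (R : realType) n : measurable (@unit_cube R n).
Proof.
apply: (@measurable_tuple_box R n (fun=> [set x : R | 0 <= x <= 1])) => i.
by rewrite -set_itvcc; exact: measurable_itv.
Qed.

Lemma measurable_tuple1 (R : realType) n (xi : n.-tuple (measurableTypeR R)) :
  measurable [set xi].
Proof.
have -> : [set xi] = [set x : n.-tuple (measurableTypeR R) | forall i, [set (tnth xi i : R)] (tnth x i)].
  by apply/seteqP; split => [x -> //|x /= h]; exact: eq_from_tnth.
by apply: (@measurable_tuple_box R n (fun i => [set (tnth xi i : R)])) => i; exact: measurable_set1.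
Qed.

Lemma edge_prob01 (R : realType) n (f : R * R -> R) (xi : n.-tuple (measurableTypeR R)) :
  (forall p, square p -> 0 <= f p <= 1) -> unit_cube xi ->
  forall i j, 0 <= edge_prob f xi i j <= 1.
Proof.
move=> f01 hxi i j; rewrite mxE; case: eqP => _; first by rewrite lexx ler01.
by apply: f01; split; apply: hxi.
Qed.

Lemma matrix_risk_ge0 (R : realType) n (that : estimator R n) (theta : 'M[R]_n) :
  (forall i j, 0 <= theta i j <= 1) -> 0 <= matrix_risk that theta.
Proof.
move=> h01; apply: sumr_ge0 => A _; apply: mulr_ge0; last exact: loss_ge0.
exact: adjacency_pmf_ge0.
Qed.

Lemma risk_le (R : realType) n (that : estimator R n) (f : R * R -> R)
    (P : probability (n.-tuple (measurableTypeR R)) R) (B : R) :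
  (forall p, square p -> 0 <= f p <= 1) -> latent_law P ->
  (forall xi, unit_cube xi -> matrix_risk that (edge_prob f xi) <= B) ->
  (risk that f P <= B%:E)%E.
Proof.
move=> f01 PC hB; rewrite /risk.
apply: (@le_trans _ _ (\int[P]_(xi in unit_cube (R:=R) (n:=n)) B%:E)%E).
  apply: ge0_le_integral_subfun => xi hxi; last by rewrite lee_fin; apply: hB.
  rewrite lee_fin; apply: matrix_risk_ge0; exact: edge_prob01.
rewrite integral_cst; last exact: measurable_unit_cube.
by move: PC; rewrite /latent_law /= => ->; rewrite mule1.
Qed.

Lemma dirac_latent_law (R : realType) n (xi : n.-tuple (measurableTypeR R)) :
  unit_cube xi -> latent_law (dirac xi : probability _ R).
Proof. by move=> hxi; rewrite /latent_law /= diracE mem_set. Qed.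

Lemma risk_dirac_ge (R : realType) n (that : estimator R n) (f : R * R -> R)
    (xi : n.-tuple (measurableTypeR R)) :
  (forall p, square p -> 0 <= f p <= 1) -> unit_cube xi ->
  ((matrix_risk that (edge_prob f xi))%:E <= risk that f (dirac xi : probability _ R))%E.
Proof.
move=> f01 hxi; rewrite /risk.
have mxi := measurable_tuple1 xi.
have r0 : 0 <= matrix_risk that (edge_prob f xi).
  by apply: matrix_risk_ge0; apply: edge_prob01.
set r := matrix_risk that _ in r0 *.
have -> : r%:E = (\int[dirac xi : probability _ R]_(x in unit_cube (R:=R) (n:=n))
    ((cst r%:E) \_ [set xi]) x)%E.
  rewrite -integral_mkcondr (_ : _ `&` _ = [set xi]).
    by rewrite integral_cst //= diracE mem_set // mule1.
  by apply/seteqP; split => [x []//|x ->]; split.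
apply: ge0_le_integral_subfun => x hx; rewrite patchE; case: ifPn => // hx1.
  by rewrite (set_mem hx1).
by rewrite lee_fin; apply: matrix_risk_ge0; apply: edge_prob01.
Qed.

(** A point mass is an admissible law of the latent variables, so that lower
    bounds need only exhibit one bad configuration of the nodes. *)
Lemma minimax_risk_ge (R : realType) n (a M B : R) :
  (forall that : estimator R n, exists f xi,
     [/\ holder_class a M f, unit_cube xi & B <= matrix_risk that (edge_prob f xi)]) ->
  (B%:E <= minimax_risk n a M)%E.
Proof.
move=> H; apply: le_ereal_inf_tmp => _ [that _ <-].
have [f [xi [hf hxi hB]]] := H that.
apply: (@le_trans _ _ (risk that f (dirac xi : probability _ R))).
  apply: le_trans (risk_dirac_ge _ _ hxi); first by rewrite lee_fin.
  by case: hf.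
apply: le_trans; last first.
  by apply: ereal_sup_ubound; exists f; [exact: hf|reflexivity].
apply: ereal_sup_ubound; exists (dirac xi : probability _ R) => //.
exact: dirac_latent_law.
Qed.

Lemma minimax_risk_le (R : realType) n (a M B : R) (that : estimator R n) :
  (forall f xi, holder_class a M f -> unit_cube xi ->
     matrix_risk that (edge_prob f xi) <= B) ->
  (minimax_risk n a M <= B%:E)%E.
Proof.
move=> H; apply: ge_ereal_inf; exists (ereal_sup [set ereal_sup [set risk that f P | P in latent_law (R:=R) (n:=n)]
  | f in holder_class a M]); first by exists that.
apply: ge_ereal_sup => _ [f hf <-]; apply: ge_ereal_sup => _ [P hP <-].
by apply: risk_le => // [|xi hxi]; [case: hf | apply: H].
Qed.

(** * Hoelder classes on the triangle *)

Section HolderBounds.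
Variable R : realType.
Implicit Types (f g : R * R -> R) (D : nat -> nat -> R * R -> R) (p q : R * R).

Definition dist1 p q : R := `|p.1 - q.1| + `|p.2 - q.2|.

Lemma dist1_ge0 p q : 0 <= dist1 p q.
Proof. exact: addr_ge0. Qed.

Lemma dist1_gt0 p q : p <> q -> 0 < dist1 p q.
Proof.
move=> pq; rewrite lt_neqAle dist1_ge0 andbT eq_sym.
apply: contra_not_neq pq => /eqP; rewrite paddr_eq0 // !normr_eq0 !subr_eq0.
by case: p q => [? ?] [? ?] /= /andP[/eqP-> /eqP->].
Qed.

Lemma sup_norm_le g (B : R) :
  (sup_norm g <= B%:E)%E <-> (forall p, triangle p -> `|g p| <= B).
Proof.
split=> [h p tp|h].
  by rewrite -lee_fin; apply: le_trans h; apply: ereal_sup_ubound; exists p.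
by apply: ge_ereal_sup => _ [p tp <-]; rewrite lee_fin; apply: h.
Qed.

Lemma holder_seminorm_le (s : R) g (B : R) :
  (holder_seminorm s g <= B%:E)%E <->
  (forall p q, triangle p -> triangle q -> p <> q ->
     `|g p - g q| <= B * dist1 p q `^ s).
Proof.
split=> [h p q tp tq pq|h].
  rewrite -ler_pdivrMr ?powR_gt0 ?dist1_gt0 // -lee_fin; apply: le_trans h.
  by apply: ereal_sup_ubound; exists (p, q).
apply: ge_ereal_sup => _ [[p q] /= [tp tq pq] <-]; rewrite lee_fin.
by rewrite ler_pdivrMr ?powR_gt0 ?dist1_gt0 //; apply: h.
Qed.

Lemma triangle00 : triangle (0, 0 : R).
Proof. by rewrite /triangle /square /= lexx ler01. Qed.

Lemma triangle10 : triangle (1, 0 : R).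
Proof. by rewrite /triangle /square /= !lexx ler01. Qed.

Lemma sup_norm_ge0 g : (0 <= sup_norm g)%E.
Proof.
apply: le_ereal_sup_tmp; exists `|g (0, 0)|%:E; last by rewrite lee_fin.
by exists (0, 0) => //; exact: triangle00.
Qed.

Lemma holder_seminorm_ge0 (s : R) g : (0 <= holder_seminorm s g)%E.
Proof.
apply: le_ereal_sup_tmp; set pq := ((1, 0) : R * R, (0, 0) : R * R).
exists (`|g pq.1 - g pq.2| / (`|pq.1.1 - pq.2.1| + `|pq.1.2 - pq.2.2|) `^ s)%:E.
  exists pq => //; split; [exact: triangle10|exact: triangle00|].
  by case => /eqP; rewrite oner_eq0.
by rewrite lee_fin divr_ge0 // powR_ge0.
Qed.

Lemma holder_norm_sup (a : R) D (B : R) : (holder_norm a D <= B%:E)%E ->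
  forall j k p, (j + k <= Num.truncn a)%N -> triangle p -> `|D j k p| <= B.
Proof.
move=> hB j k p jk; apply/sup_norm_le: p; apply: le_trans hB.
rewrite /holder_norm; set m := Num.truncn a in jk *.
have [jm km] : (j < m.+1)%N /\ (k < m.+1)%N by lia.
apply: le_trans; last first.
  apply: leeDl; apply: (@le_trans _ _ (holder_seminorm (a - m%:R) (D m 0%N))).
    exact: holder_seminorm_ge0.
  apply: (le_bigmax_cond -oo%E (fun jk : 'I_m.+1 * 'I_m.+1 =>
     holder_seminorm (a - m%:R) (D jk.1 jk.2)) (j := (ord_max, ord0))).
  by rewrite /= addn0.
exact: (le_bigmax_cond -oo%E (fun jk : 'I_m.+1 * 'I_m.+1 =>
     sup_norm (D jk.1 jk.2)) (j := (Ordinal jm, Ordinal km))).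
Qed.

Lemma holder_norm_semi (a : R) D (B : R) : (holder_norm a D <= B%:E)%E ->
  forall p q, triangle p -> triangle q -> p <> q ->
  `|D (Num.truncn a) 0%N p - D (Num.truncn a) 0%N q|
     <= B * dist1 p q `^ (a - (Num.truncn a)%:R).
Proof.
move=> hB; apply/holder_seminorm_le; apply: le_trans hB.
rewrite /holder_norm; set m := Num.truncn a.
apply: le_trans; last first.
  apply: leeDr; apply: (@le_trans _ _ (sup_norm (D 0%N 0%N))).
    exact: sup_norm_ge0.
  exact: (le_bigmax_cond -oo%E (fun jk : 'I_m.+1 * 'I_m.+1 =>
     sup_norm (D jk.1 jk.2)) (j := (ord0, ord0))).
apply: (le_bigmax_cond -oo%E (fun jk : 'I_m.+1 * 'I_m.+1 =>
     holder_seminorm (a - m%:R) (D jk.1 jk.2)) (j := (ord_max, ord0))).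
by rewrite /= addn0.
Qed.

Lemma holder_norm_le (a : R) D (B1 B2 : R) :
  (forall j k p, (j + k <= Num.truncn a)%N -> triangle p -> `|D j k p| <= B1) ->
  (forall j k p q, (j + k = Num.truncn a)%N -> triangle p -> triangle q -> p <> q ->
     `|D j k p - D j k q| <= B2 * dist1 p q `^ (a - (Num.truncn a)%:R)) ->
  (holder_norm a D <= (B1 + B2)%:E)%E.
Proof.
move=> h1 h2; rewrite /holder_norm EFinD; apply: leeD.
  apply: bigmax_le => [|[j k] /= jk]; first exact: leNye.
  by apply/sup_norm_le => p; apply: h1.
apply: bigmax_le => [|[j k] /= /eqP jk]; first exact: leNye.
by apply/holder_seminorm_le => p q; apply: h2.
Qed.

(** A difference quotient taken within the interval is an ordinary one inside
    it, and gives one-sided continuity at its ends: enough for the mean value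
    theorem. *)
Lemma within_quotient_lipschitz (g dg : R -> R) (a b L : R) : a <= b ->
  (forall x, a <= x <= b ->
     h^-1 * (g (x + h) - g x)
       @[h --> within [set h | a <= x + h <= b] 0^'] --> dg x) ->
  (forall x, a <= x <= b -> `|dg x| <= L) ->
  `|g b - g a| <= L * (b - a).
Proof.
move=> ab hg hL.
have hq x e : a <= x <= b -> 0 < e -> exists2 d, 0 < d &
    forall h, `|h| < d -> h != 0 -> a <= x + h <= b ->
      `|dg x - h^-1 * (g (x + h) - g x)| < e.
  move=> hx e0; have /cvgrPdist_lt /(_ e e0) := hg x hx.
  move=> /nbhs_ballP[d /= d0 hd]; exists d => // h hd' h0 hab.
  by apply: hd => //=; rewrite /ball /= sub0r normrN.
have [||c hc ->] := @MVT_segment R g dg a b ab.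
- move=> x /[!in_itv] /= /andP[ax xb].
  have hx : a <= x <= b by rewrite !ltW.
  suff H : h^-1 *: ((g \o shift x) (h *: 1) - g x) @[h --> 0^'] --> dg x.
    by apply: DeriveDef; [apply/cvg_ex; exists (dg x)|apply: cvg_lim].
  apply/cvgrPdist_lt => e e0; have [d d0 hd] := hq x e hx e0.
  apply/nbhs_ballP; exists (Num.min d (Num.min (x - a) (b - x))).
    by rewrite /= !lt_min d0 !subr_gt0 ax xb.
  move=> h /=; rewrite /ball /= sub0r normrN !lt_min => /and3P[h1 h2 h3] h0.
  rewrite [h *: 1]mulr1 [h + x]addrC; apply: hd => //.
  by move: h2 h3; rewrite !ltr_norml => /andP[? ?] /andP[? ?]; apply/andP; split; lra.
- apply/subspace_continuousP => x /= /[!in_itv] /= hx; apply/cvgrPdist_lt => e e0.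
  have [d d0 hd] := hq x 1 hx ltr01.
  have L0 : 0 <= L by apply: le_trans (hL x hx).
  apply/nbhs_ballP; exists (Num.min d (e / (L + 1))).
    by rewrite /= lt_min d0 divr_gt0 // ltr_wpDl.
  move=> y /=; rewrite /ball /= lt_min => /andP[h1 h2] /[!in_itv] /= hy.
  have [->|xy] := eqVneq x y; first by rewrite subrr normr0.
  have h0 : y - x != 0 by rewrite subr_eq0 eq_sym.
  have := hd (y - x); rewrite distrC h1 h0 addrC subrK hy => /(_ isT isT isT) hh.
  have : `|(y - x)^-1 * (g y - g x)| < L + 1.
    have := ler_normB (dg x) (dg x - (y - x)^-1 * (g y - g x)).
    rewrite opprB addrC subrK; have := hL x hx; lra.
  rewrite normrM normfV ltr_pdivrMl ?normr_gt0 // => h3.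
  rewrite distrC; apply: lt_trans h3 _; rewrite distrC -ltr_pdivlMr //.
  by rewrite ltr_wpDl.
have hc' : a <= c <= b by move: hc; rewrite in_itv.
rewrite normrM [`|b - a|]ger0_norm ?subr_ge0 //.
by apply: ler_wpM2r; [rewrite subr_ge0 | apply: hL].
Qed.

Lemma within_subset_cvg (T : Type) (U : topologicalType) (F : set_system T)
    {FF : Filter F} (A B : set T) (u : T -> U) (l : U) :
  A `<=` B -> u @ within B F --> l -> u @ within A F --> l.
Proof.
move=> AB h P Pl; have hP : F [set x | B x -> P (u x)] by exact: h Pl.
change (F [set x | A x -> P (u x)]).
by apply: filterS hP => x hx /AB.
Qed.

Lemma partials_lipschitz (m : nat) f D (B : R) :
  (0 < m)%N -> partials m f D ->
  (forall j k p, (j + k <= m)%N -> triangle p -> `|D j k p| <= B) ->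
  forall p q, triangle p -> triangle q -> `|f p - f q| <= B * dist1 p q.
Proof.
move=> m0 [D0 Dy Dx] hB.
have B0 : 0 <= B by apply: le_trans (hB 0%N 0%N (0, 0) _ triangle00).
have hx x1 x2 y : 0 <= y -> y <= x1 -> x1 <= x2 -> x2 <= 1 ->
    `|f (x2, y) - f (x1, y)| <= B * (x2 - x1).
  move=> y0 yx x12 x1'.
  have tx x : x1 <= x <= x2 -> triangle (x, y).
    by move=> /andP[? ?]; split; [split|] => /=; [apply/andP; split|apply/andP; split|]; lra.
  rewrite -(D0 (x1, y)); last by apply: tx; rewrite lexx.
  rewrite -(D0 (x2, y)); last by apply: tx; rewrite lexx andbT.
  apply: (@within_quotient_lipschitz (fun x => D 0%N 0%N (x, y)) (fun x => D 1%N 0%N (x, y))) => //.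
    move=> x hx; have := Dx 0%N 0%N (x, y) m0 (tx x hx).
    by apply: within_subset_cvg => h /=; apply: tx.
  by move=> x hx; apply: hB (tx x hx); rewrite addn0.
have hy x y1 y2 : 0 <= y1 -> y1 <= y2 -> y2 <= x -> x <= 1 ->
    `|f (x, y2) - f (x, y1)| <= B * (y2 - y1).
  move=> y0 y12 yx x1'.
  have ty y : y1 <= y <= y2 -> triangle (x, y).
    by move=> /andP[? ?]; split; [split|] => /=; [apply/andP; split|apply/andP; split|]; lra.
  rewrite -(D0 (x, y1)); last by apply: ty; rewrite lexx.
  rewrite -(D0 (x, y2)); last by apply: ty; rewrite lexx andbT.
  apply: (@within_quotient_lipschitz (fun y => D 0%N 0%N (x, y)) (fun y => D 0%N 1%N (x, y))) => //.
    move=> y hy; have := Dy 0%N (x, y) m0 (ty y hy).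
    by apply: within_subset_cvg => h /=; apply: ty.
  by move=> y hy; apply: hB (ty y hy); rewrite add0n.
have hxn x1 x2 y : 0 <= y -> y <= x1 -> y <= x2 -> x1 <= 1 -> x2 <= 1 ->
    `|f (x1, y) - f (x2, y)| <= B * `|x1 - x2|.
  move=> y0 ? ? ? ?; have [h|/ltW h] := leP x1 x2.
    by rewrite distrC (distrC x1) [`|x2 - x1|]ger0_norm ?subr_ge0 //; apply: hx.
  by rewrite [`|x1 - x2|]ger0_norm ?subr_ge0 //; apply: hx.
have hyn x y1 y2 : 0 <= y1 -> 0 <= y2 -> y1 <= x -> y2 <= x -> x <= 1 ->
    `|f (x, y1) - f (x, y2)| <= B * `|y1 - y2|.
  move=> ? ? ? ? ?; have [h|/ltW h] := leP y1 y2.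
    by rewrite distrC (distrC y1) [`|y2 - y1|]ger0_norm ?subr_ge0 //; apply: hy.
  by rewrite [`|y1 - y2|]ger0_norm ?subr_ge0 //; apply: hy.
(* The vertical move is made on the side of the larger abscissa, where the
   whole segment stays in the triangle. *)
move=> [x1 y1] [x2 y2] [[/= /andP[? ?] /andP[? ?]] ?] [[/= /andP[? ?] /andP[? ?]] ?].
rewrite /dist1 /= mulrDr; have [h|/ltW h] := leP x1 x2.
  have -> : f (x1, y1) - f (x2, y2) =
    (f (x1, y1) - f (x2, y1)) + (f (x2, y1) - f (x2, y2)) by ring.
  by apply: le_trans (ler_normD _ _) _; apply: lerD; [apply: hxn|apply: hyn]; lra.
have -> : f (x1, y1) - f (x2, y2) =
  (f (x1, y2) - f (x2, y2)) + (f (x1, y1) - f (x1, y2)) by ring.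
by apply: le_trans (ler_normD _ _) _; apply: lerD; [apply: hxn|apply: hyn]; lra.
Qed.

(** Reflecting both points into the triangle does not increase their
    distance, so that the modulus of continuity extends to the square. *)
Lemma dist1_sort p q :
  dist1 (Num.max p.1 p.2, Num.min p.1 p.2) (Num.max q.1 q.2, Num.min q.1 q.2) <= dist1 p q.
Proof.
have key (a b c d : R) : a <= b -> d <= c -> `|b - c| + `|a - d| <= `|a - c| + `|b - d|.
  by case: (lerP b c); case: (lerP a d); case: (lerP a c); case: (lerP b d); lra.
rewrite /dist1 /=; case: p q => [a b] [c d] /=.
have [ab|/ltW ab] := leP a b; have [cd|/ltW cd] := leP c d => //.
- by rewrite addrC.
- exact: key.
- by rewrite [leRHS]addrC; apply: key.
Qed.

Lemma holder_class_modulus (a M : R) f p q : 0 < a -> holder_class a M f ->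
  square p -> square q -> `|f p - f q| <= M * dist1 p q `^ (Num.min a 1).
Proof.
move=> a0 [f01 fsym [D [hD hM]]] sp sq.
pose s p : R * R := (Num.max p.1 p.2, Num.min p.1 p.2).
have fs x : square x -> f x = f (s x).
  move=> sx; rewrite /s; case: leP => _; last by case: (x).
  by rewrite fsym.
have ts x : square x -> triangle (s x).
  move=> [h1 h2]; rewrite /s; case: leP => h; first by split; [split|].
  by split; [split|apply: ltW].
have M0 : 0 <= M.
  apply: (@le_trans _ _ `|D 0%N 0%N (0, 0)|) => //.
  exact: (@holder_norm_sup a D M hM 0%N 0%N (0, 0) (leq0n _) triangle00).
have H x y : triangle x -> triangle y -> `|f x - f y| <= M * dist1 x y `^ (Num.min a 1).
  move=> tx ty; have [a1|a1] := ltP a 1.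
    have t0 : Num.truncn a = 0%N by apply/truncn_def; rewrite ltW.
    have [->|/eqP xy] := eqVneq x y.
      by rewrite subrr normr0 mulr_ge0 // powR_ge0.
    have [D0 _ _] := hD; rewrite -!D0 //.
    by have := holder_norm_semi hM tx ty xy; rewrite t0 subr0.
  rewrite powRr1 ?dist1_ge0 //; apply: partials_lipschitz hD _ _ _ tx ty => //.
    by rewrite truncn_gt0.
  exact: holder_norm_sup hM.
rewrite (fs p) // (fs q) //; apply: le_trans (H _ _ (ts p sp) (ts q sq)) _.
apply: ler_wpM2l => //; apply: ge0_ler_powR; rewrite ?nnegrE ?dist1_ge0 //.
  by rewrite le_min (ltW a0) ler01.
exact: dist1_sort.
Qed.

End HolderBounds.

(** * A net of piecewise constant graphons *)

Section Net.
Variables (R : realType) (n K L : nat).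

(** Parameters of a piecewise constant candidate on a grid of [K.+1] by [K.+1]
    cells: the cell of each node, a starting level, and one bounded increment
    per cell.  Coding a smooth function by its increments, instead of its
    values, saves the logarithmic factor of a naive discretization. *)
Definition net_index : finType :=
  ({ffun 'I_n -> 'I_K.+1} * ('I_K.+2 * {ffun 'I_K.+1 * 'I_K.+1 -> 'I_(2 * L).+1}))%type.

Definition increment (inc : {ffun 'I_K.+1 * 'I_K.+1 -> 'I_(2 * L).+1}) a b : R :=
  (inc (a, b))%:R - L%:R.

(** The level of a cell is read along the path that climbs the first column
    and then follows a row. *)
Definition net_level (s : nat) inc (a b : 'I_K.+1) : R :=
  s%:R + \sum_(0 <= i < a) increment inc (inord i.+1) ord0
       + \sum_(0 <= i < b) increment inc a (inord i.+1).

Lemma card_net_index :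
  #|net_index| = (K.+1 ^ n * (K.+2 * (2 * L).+1 ^ (K.+1 * K.+1)))%N.
Proof. by rewrite !card_prod !card_ffun !card_prod !card_ord. Qed.

Lemma net_level_surj (Q : 'I_K.+1 -> 'I_K.+1 -> nat) :
  (forall a b, Q a b <= K.+1)%N ->
  (forall a b a' b' : 'I_K.+1, (a' - a + (a - a') + (b' - b + (b - b')) <= 1)%N ->
     (Q a b <= Q a' b' + L)%N) ->
  exists (s : 'I_K.+2) inc, forall a b, net_level s inc a b = (Q a b)%:R.
Proof.
move=> Qle Qd.
(* The predecessor of a cell along the path that [net_level] follows. *)
pose prev (ab : 'I_K.+1 * 'I_K.+1) : nat :=
  if ab.2 == ord0 then Q (inord ab.1.-1) ord0 else Q ab.1 (inord ab.2.-1).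
pose inc := [ffun ab : 'I_K.+1 * 'I_K.+1 => inord (Q ab.1 ab.2 + L - prev ab) : 'I_(2 * L).+1].
have incE a b : (Q a b <= prev (a, b) + L)%N -> (prev (a, b) <= Q a b + L)%N ->
    increment inc a b = (Q a b)%:R - (prev (a, b))%:R.
  move=> h1 h2; rewrite /increment ffunE /= inordK; last by lia.
  by rewrite natrB // natrD; ring.
exists (inord (Q ord0 ord0)), inc => a b.
rewrite /net_level inordK; last by rewrite ltnS; apply: Qle.
have -> : \sum_(0 <= i < a) increment inc (inord i.+1) ord0 =
    \sum_(0 <= i < a) ((Q (inord i.+1) ord0)%:R - (Q (inord i) ord0)%:R).
  apply: eq_big_nat => i /andP[_ ia]; have := ltn_ord a => aK.
  have h1 : (inord i.+1 : 'I_K.+1) = i.+1 :> nat by rewrite inordK //; lia.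
  have h0 : (inord i : 'I_K.+1) = i :> nat by rewrite inordK //; lia.
  have pE : prev (inord i.+1, ord0) = Q (inord i) ord0 by rewrite /prev /= h1.
  by rewrite incE ?pE //; apply: Qd; rewrite h0 h1 /=; lia.
have -> : \sum_(0 <= i < b) increment inc a (inord i.+1) =
    \sum_(0 <= i < b) ((Q a (inord i.+1))%:R - (Q a (inord i))%:R).
  apply: eq_big_nat => i /andP[_ ib]; have := ltn_ord b => bK.
  have h1 : (inord i.+1 : 'I_K.+1) = i.+1 :> nat by rewrite inordK //; lia.
  have h0 : (inord i : 'I_K.+1) = i :> nat by rewrite inordK //; lia.
  have pE : prev (a, inord i.+1) = Q a (inord i).
    rewrite /prev /=; case: eqP => [e|_]; last by rewrite h1.
    by have := congr1 val e; rewrite /= h1.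
  by rewrite incE ?pE //; apply: Qd; rewrite h0 h1 /=; lia.
rewrite (telescope_sumr (fun i => (Q (inord i) ord0)%:R : R)) //.
rewrite (telescope_sumr (fun i => (Q a (inord i))%:R : R)) // !inord_val.
have -> : (inord 0 : 'I_K.+1) = ord0 by apply: val_inj; rewrite /= inordK.
by ring.
Qed.

Definition clip (x : R) : R := Num.max 0 (Num.min 1 x).

Lemma clip01 x : 0 <= clip x <= 1.
Proof. by rewrite /clip le_max lexx /= ge_max ler01 ge_min lexx. Qed.

Lemma clip_dist x t : 0 <= t <= 1 -> `|clip x - t| <= `|x - t|.
Proof.
move=> /andP[t0 t1]; rewrite /clip.
have := ler_norm (x - t); have := ler_norm (t - x); rewrite distrC => n1 n2.
have [h1|h1] := leP 1 x; last have [h2|h2] := leP 0 x => //.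
  by rewrite max_r ?ler01 // ger0_norm; lra.
by rewrite ler0_norm; lra.
Qed.

(** Only the entries below the diagonal are read from the levels: the coded
    table need not be symmetric. *)
Definition net_matrix (e : R) (w : net_index) : 'M[R]_n :=
  \matrix_(i, j)
    let v i j := clip (e * net_level w.2.1 w.2.2 (w.1 i) (w.1 j)) in
    if (j < i)%N then v i j else if (i < j)%N then v j i else 0.

Lemma net_matrix01 e w i j : 0 <= net_matrix e w i j <= 1.
Proof.
by rewrite mxE /=; case: ifP => _; [|case: ifP => _]; rewrite ?clip01 // lexx ler01.
Qed.

Lemma net_matrix_sym e w i j : net_matrix e w i j = net_matrix e w j i.
Proof. by rewrite !mxE /=; case: ltngtP. Qed.

Lemma net_matrix_diag e w i : net_matrix e w i i = 0.
Proof. by rewrite mxE ltnn. Qed.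

(** The endpoint 1 is put into the last cell. *)
Definition cell_of (x : R) : 'I_K.+1 := inord (minn (Num.truncn (K.+1%:R * x)) K).

Lemma cell_of_dist x : 0 <= x <= 1 -> `|x - (cell_of x)%:R / K.+1%:R| <= K.+1%:R^-1.
Proof.
move=> /andP[x0 x1]; rewrite /cell_of inordK; last by rewrite ltnS geq_minr.
have k0 : 0 < K.+1%:R :> R by rewrite ltr0n.
have kx0 : 0 <= K.+1%:R * x by rewrite mulr_ge0 // ltW.
have /andP[h1 h2] := truncn_itv kx0.
have -> : x - (minn (Num.truncn (K.+1%:R * x)) K)%:R / K.+1%:R =
    K.+1%:R^-1 * (K.+1%:R * x - (minn (Num.truncn (K.+1%:R * x)) K)%:R).
  by field; rewrite addrC natr1 gt_eqF.
rewrite normrM ger0_norm ?invr_ge0 // -[leRHS]mulr1 ler_pM2l ?invr_gt0 //.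
have kx1 : K.+1%:R * x <= K.+1%:R by rewrite -[leRHS]mulr1; apply: ler_wpM2l.
move: kx1 kx0 h1 h2; set y := K.+1%:R * x; rewrite -!natr1 => kx1 kx0 h1 h2.
case: (leqP (Num.truncn y) K) => h; first by rewrite ger0_norm; lra.
have hK : K%:R + 1 <= (Num.truncn y)%:R :> R by rewrite natr1 ler_nat.
by rewrite ger0_norm; lra.
Qed.

End Net.

(** The values at the grid points are quantized in steps of [k^(-b)], the
    modulus of continuity at the size of a cell; they change by a bounded
    number of steps between neighbours, so that the net can code them. *)
Lemma net_approximation (R : realType) n K (b M : R) (f : R * R -> R)
    (xi : n.-tuple (measurableTypeR R)) :
  0 < b <= 1 -> 0 <= M ->
  (forall p, square p -> 0 <= f p <= 1) ->
  (forall p, square p -> f p = f (p.2, p.1)) ->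
  (forall p q, square p -> square q -> `|f p - f q| <= M * dist1 p q `^ b) ->
  unit_cube xi ->
  let e := K.+1%:R `^ (- b) in
  exists w : net_index n K (Num.truncn M).+2,
    sqdist (net_matrix e w) (edge_prob f xi) <= (n%:R * ((1 + 2 * M) * e)) ^+ 2.
Proof.
move=> /andP[b0 b1] M0 f01 fsym fH hxi e.
have k0 : 0 < K.+1%:R :> R by rewrite ltr0n.
have k1 : 1 <= K.+1%:R :> R by rewrite ler1n.
have e0 : 0 < e by apply: powR_gt0.
have eE : e = (K.+1%:R^-1) `^ b by rewrite /e -mulN1r powRrM powR_inv1 ?ler0n.
set L := (Num.truncn M).+2.
pose g (a : 'I_K.+1) : R := a%:R / K.+1%:R.
have g01 a : 0 <= g a <= 1.
  apply/andP; split; first by rewrite divr_ge0.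
  by rewrite ler_pdivrMr // mul1r ler_nat ltnW.
have sq a c : square (g a, g c) by split; apply: g01.
pose Q a c := Num.truncn (f (g a, g c) / e).
have F0 a c : 0 <= f (g a, g c) / e.
  by have /andP[? ?] := f01 _ (sq a c); apply: divr_ge0 => //; apply: ltW.
have Qitv a c : (Q a c)%:R <= f (g a, g c) / e < (Q a c)%:R + 1.
  by rewrite natr1; apply: truncn_itv.
have Qle a c : (Q a c <= K.+1)%N.
  rewrite -(ler_nat R); have /andP[h _] := Qitv a c; apply: le_trans h _.
  have /andP[_ h1] := f01 _ (sq a c).
  rewrite ler_pdivrMr // /e powRN ler_pdivlMr ?powR_gt0 //.
  apply: le_trans (_ : 1 * K.+1%:R `^ b <= _).
    by apply: ler_wpM2r; rewrite ?powR_ge0.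
  by rewrite mul1r -[leRHS]powRr1 ?ler0n //; apply: ler_powR.
have Qd (a c a' c' : 'I_K.+1) : (a' - a + (a - a') + (c' - c + (c - c')) <= 1)%N ->
    (Q a c <= Q a' c' + L)%N.
  move=> h.
  have hd : dist1 (g a, g c) (g a', g c') <= K.+1%:R^-1.
    rewrite /dist1 /= /g -!mulrBl !normrM !(ger0_norm (x := K.+1%:R^-1)) ?invr_ge0 //.
    rewrite -mulrDl -[leRHS]mul1r ler_pM2r ?invr_gt0 //.
    have dn (x y : nat) : `|x%:R - y%:R| = (y - x + (x - y))%:R :> R.
      have [xy|yx] := leqP x y.
        rewrite (eqP xy) addn0 natrB // distrC ger0_norm // subr_ge0 ler_nat //.
      rewrite (_ : (y - x)%N = 0%N) ?natrB ?ger0_norm ?subr_ge0 ?ler_nat //; lia.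
    by rewrite !dn -natrD lern1.
  have hf : `|f (g a, g c) - f (g a', g c')| <= M * e.
    apply: le_trans (fH _ _ (sq a c) (sq a' c')) _; apply: ler_wpM2l => //.
    by rewrite eE; apply: ge0_ler_powR; rewrite ?nnegrE ?(ltW b0) ?dist1_ge0 ?invr_ge0.
  have hf' : f (g a, g c) / e - f (g a', g c') / e <= M.
    rewrite -mulrBl ler_pdivrMr //; exact: le_trans (ler_norm _) hf.
  have /andP[h1 _] := Qitv a c; have /andP[_ h2] := Qitv a' c'.
  have /andP[_ h3] := truncn_itv M0.
  rewrite -ltnS -(ltr_nat R) /L -!natr1 natrD -!natr1; move: h3; rewrite -natr1; lra.
have [s [inc hinc]] := net_level_surj R Qle Qd.
exists ([ffun i => cell_of K (tnth xi i : R)], (s, inc)).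
have step p : lower p ->
    (net_matrix e ([ffun i => cell_of K (tnth xi i : R)], (s, inc)) p.1 p.2 -
     edge_prob f xi p.1 p.2) ^+ 2 <= ((1 + 2 * M) * e) ^+ 2.
  move=> lp; have /andP[t0 t1] := edge_prob01 f01 hxi p.1 p.2.
  have sp : square (tnth xi p.1 : R, tnth xi p.2 : R) by split; apply: hxi.
  rewrite -real_normK ?num_real // ler_sqr ?nnegrE //; last first.
    by rewrite mulr_ge0 ?(ltW e0) // addr_ge0 // mulr_ge0.
  have lp' : (p.2 < p.1)%N by [].
  rewrite mxE /= lp'; apply: le_trans (clip_dist _ _) _; first by rewrite t0 t1.
  rewrite mxE ifN; last by rewrite -val_eqE /= neq_ltn lp' orbT.
  rewrite /= hinc !ffunE; set a := cell_of K _; set c := cell_of K _.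
  have hq : `|e * (Q a c)%:R - f (g a, g c)| <= e.
    have -> : e * (Q a c)%:R - f (g a, g c) = e * ((Q a c)%:R - f (g a, g c) / e).
      by field; rewrite gt_eqF.
    rewrite normrM gtr0_norm // -[leRHS]mulr1 ler_pM2l //.
    by have /andP[? ?] := Qitv a c; rewrite ler_norml; apply/andP; split; lra.
  have hd : dist1 (g a, g c) (tnth xi p.1 : R, tnth xi p.2 : R) <= 2 * K.+1%:R^-1.
    rewrite /dist1 /= mulr2n mulrDl mul1r; apply: lerD; rewrite distrC; apply: cell_of_dist; exact: hxi.
  have hf := fH _ _ (sq a c) sp.
  have hM : M * dist1 (g a, g c) (tnth xi p.1 : R, tnth xi p.2 : R) `^ b <= 2 * M * e.
    rewrite -mulrA mulrCA; apply: ler_wpM2l => //.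
    apply: (@le_trans _ _ ((2 * K.+1%:R^-1) `^ b)).
      apply: ge0_ler_powR; rewrite ?nnegrE ?(ltW b0) ?dist1_ge0 ?mulr_ge0 ?invr_ge0 //.
    rewrite powRM ?invr_ge0 // -eE; apply: ler_wpM2r; first exact: ltW.
    by rewrite -[leRHS]powRr1 //; apply: ler_powR => //; rewrite ler1n.
  have := ler_distD (f (g a, g c)) (e * (Q a c)%:R) (f (tnth xi p.1 : R, tnth xi p.2 : R)).
  lra.
rewrite /sqdist; apply: le_trans (ler_sum _ step) _.
rewrite sumr_const -[leLHS]mulr_natl [leRHS]exprMn; apply: ler_wpM2r; first exact: sqr_ge0.
rewrite -natrX ler_nat; apply: leq_trans (max_card _) _.
by rewrite card_prod card_ord.
Qed.

(** Risk of least squares over the net: approximation, labelling of the nodes,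
    and entropy of the table of levels. *)
Lemma net_least_squares_risk (R : realType) n K (a M : R) :
  0 < a -> 0 <= M -> exists that : estimator R n, forall f xi,
  holder_class a M f -> unit_cube xi ->
  matrix_risk that (edge_prob f xi) <= (n%:R ^+ 2)^-1 * (2 *
    (3 * (n%:R * ((1 + 2 * M) * K.+1%:R `^ (- Num.min a 1))) ^+ 2 +
     64 * (n%:R * ln K.+1%:R + (ln K.+2%:R +
           K.+1%:R ^+ 2 * ln (2 * (Num.truncn M).+2).+1%:R)))).
Proof.
move=> a0 M0; set b := Num.min a 1; set e := K.+1%:R `^ (- b).
have hb : 0 < b <= 1 by rewrite lt_min a0 ltr01 ge_min lexx orbT.
pose w0 : net_index n K (Num.truncn M).+2 := ([ffun=> ord0], (ord0, [ffun=> ord0])).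
exists (least_squares w0 (net_matrix e)) => f xi hf hxi.
have [f01 fsym _] := hf.
have [w hw] := net_approximation K hb M0 f01 fsym
  (fun p q sp sq => holder_class_modulus a0 hf sp sq) hxi.
have h01 := edge_prob01 f01 hxi.
rewrite /matrix_risk.
under eq_bigr => A _.
  rewrite loss_sqdist; first last.
  - by move=> i; rewrite /least_squares net_matrix_diag mxE eqxx.
  - move=> i j; rewrite !mxE eq_sym; case: ifP => // _; apply: fsym; split; exact: hxi.
  - by move=> i j; apply: net_matrix_sym.
  rewrite mulrCA (mulrCA _ 2).
  over.
rewrite /= -mulr_sumr; apply: ler_wpM2l; first by rewrite invr_ge0 exprn_ge0.
rewrite -mulr_sumr ler_pM2l //.
apply: le_trans (least_squares_risk w0 w h01 (net_matrix01 e)) _.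
apply: lerD; first by rewrite ler_pM2l.
rewrite ler_pM2l // card_net_index !natrM !natrX.
rewrite !lnM ?posrE ?mulr_gt0 ?exprn_gt0 ?ltr0n // !lnXn ?ltr0n //.
by rewrite expr2 -natrM !mulr_natl.
Qed.

(** * The upper bound *)

(** The best compromise between the bias of a piecewise constant approximation
    of a [b]-Hoelder function and its number of cells. *)
Definition smooth_rate (R : realType) (b : R) n : R := n%:R `^ (- (2 * b / (b + 1))).

(** With [k] of the order of [n^(1 / (1 + b))], the squared bias [e^2] and the
    number [k^2 / n^2] of cells per pair of nodes have the same order. *)
Lemma balanced_grid (R : realType) (b : R) n : 0 < b <= 1 -> (0 < n)%N ->
  exists K : nat, let k := K.+1%:R : R in let e := k `^ (- b) in
  [/\ n%:R <= k * k `^ b, k <= 2 * n%:R,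
      k ^+ 2 <= 4 * (n%:R ^+ 2 * smooth_rate b n),
      e ^+ 2 <= smooth_rate b n & smooth_rate b n <= 4 * e ^+ 2].
Proof.
move=> /andP[b0 b1] n0; have n0R : 0 < n%:R :> R by rewrite ltr0n.
have n1 : 1 <= n%:R :> R by rewrite ler1n.
pose x : R := n%:R `^ (1 + b)^-1.
have b10 : 1 + b != 0 by rewrite gt_eqF // ltr_wpDr ?ltW.
have x1 : 1 <= x.
  by rewrite -(powRr0 n%:R); apply: ler_powR; rewrite // invr_ge0 ltW // ltr_wpDr ?ltW.
have x0 : 0 < x by apply: lt_le_trans x1.
have xn : x `^ (1 + b) = n%:R by rewrite -powRrM mulVf // powRr1 // ltW.
have xle : x <= n%:R by apply: ler1_powR => //; rewrite invf_le1 ?lerDl ?ltW // ltr_wpDr ?ltW.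
have xb : x * x `^ b = n%:R.
  by rewrite -xn powRD ?(negbTE b10) // powRr1 // ltW.
have rho : smooth_rate b n = x `^ (- b) ^+ 2.
  rewrite /smooth_rate -powR_mulrn ?powR_ge0 // -powRrM -powRrM.
  by congr (_ `^ _); field; rewrite ?(addrC b) ?b10.
have xbN : x `^ (- b) * x `^ b = 1.
  by rewrite powRN mulVf // gt_eqF // powR_gt0.
exists (Num.truncn x); have /andP[t1 t2] := truncn_itv (ltW x0).
set k := (Num.truncn x).+1%:R in t2 *; have k2 : k <= 2 * x.
  by rewrite /k -natr1; lra.
have k0 : 0 < k by apply: lt_trans t2.
have kb : k `^ (- b) <= x `^ (- b).
  rewrite !powRN lef_pV2 ?posrE ?powR_gt0 //.
  by apply: ge0_ler_powR; rewrite ?nnegrE ltW.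
have bk : x `^ (- b) <= 2 * k `^ (- b).
  rewrite !powRN ler_pdivlMr ?powR_gt0 // mulrC ler_pdivrMr ?powR_gt0 //.
  apply: (@le_trans _ _ ((2 * x) `^ b)).
    by apply: ge0_ler_powR; rewrite ?nnegrE ?(ltW b0) ?(ltW k0) ?mulr_ge0 ?(ltW x0).
  rewrite powRM ?(ltW x0) //; apply: ler_wpM2r; first exact: powR_ge0.
  by apply: ler1_powR => //; rewrite ler1n.
split.
- rewrite -xb; apply: ler_pM; rewrite ?powR_ge0 ?(ltW x0) ?(ltW t2) //.
  by apply: ge0_ler_powR; rewrite ?nnegrE ltW.
- by apply: le_trans k2 _; rewrite ler_pM2l.
- have -> : n%:R ^+ 2 * smooth_rate b n = x ^+ 2.
    by rewrite rho -xb -exprMn -mulrA [_ `^ b * _]mulrC xbN mulr1.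
  have := ler_pM (ltW k0) (ltW k0) k2 k2; rewrite !expr2; lra.
- by rewrite rho; apply: lerXn2r kb; rewrite nnegrE powR_ge0.
- rewrite rho; have := ler_pM (powR_ge0 x (- b)) (powR_ge0 x (- b)) bk bk.
  by rewrite !expr2; lra.
Qed.

Lemma ln2_ge_half (R : realType) : 1 / 2 <= ln 2 :> R.
Proof. by rewrite -[leLHS]expRK ler_ln ?posrE ?expR_gt0 // expR_half_le2. Qed.

Lemma ln_nat_ge_half (R : realType) n : (2 <= n)%N -> 1 / 2 <= ln (n%:R : R).
Proof.
move=> n2; apply: le_trans (ln2_ge_half R) _.
by rewrite ler_ln ?posrE ?ltr0n ?ler_nat //; lia.
Qed.

(** The cost [ln n / n] of labelling the nodes is dominated by the smooth rate
    below smoothness 1, and dominates it from there on. *)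
Lemma rates_le_rate (R : realType) (a : R) : 0 < a -> exists2 C : R, 0 < C &
  forall n, (2 <= n)%N ->
    smooth_rate (Num.min a 1) n + ln n%:R / n%:R <= C * rate a n.
Proof.
move=> a0; rewrite /rate; have [a1|a1] := ltP a 1; last first.
  exists 3 => // n n2; rewrite /smooth_rate.
  have n0 : 0 < n%:R :> R by rewrite ltr0n; lia.
  rewrite (_ : - (2 * 1 / (1 + 1)) = -1 :> R); last by field.
  have ni0 : 0 <= n%:R^-1 :> R by rewrite invr_ge0 ltW.
  by have := ler_wpM2r ni0 (ln_nat_ge_half R n2); rewrite powR_inv1 ?(ltW n0) //; lra.
exists (1 + (1 + a) / (1 - a)).
  by rewrite addr_gt0 // divr_gt0 ?subr_gt0 // addr_gt0.
move=> n n2; have n0 : 0 < n%:R :> R by rewrite ltr0n; lia.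
rewrite [leRHS]mulrDl mul1r lerD2l.
(* [n^s / n] is the smooth rate, and [ln n <= n^s / s]. *)
pose s := (1 - a) / (1 + a).
have s0 : 0 < s by rewrite divr_gt0 ?subr_gt0 // addr_gt0.
have a10 : 1 + a != 0 by rewrite gt_eqF // addr_gt0.
have a1' : 1 - a != 0 by rewrite gt_eqF // subr_gt0.
have <- : n%:R `^ s / n%:R = n%:R `^ (- (2 * a / (a + 1))).
  rewrite -[X in _ / X](@powRr1 R n%:R) ?(ltW n0) // -powRB ?(gt_eqF n0) ?implybT //.
  by congr (_ `^ _); rewrite /s; field; rewrite addrC.
rewrite mulrA ler_pM2r ?invr_gt0 //.
have -> : (1 + a) / (1 - a) = s^-1 by rewrite /s invf_div.
by rewrite ler_pdivlMl // -ln_powR; apply/ltW/ln_sublinear/powR_gt0.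
Qed.

Lemma minimax_upper_bound (R : realType) (a M : R) : 0 < a -> 0 < M ->
  exists2 C : R, 0 < C & forall n, (2 <= n)%N ->
    (minimax_risk n a M <= (C * rate a n)%:E)%E.
Proof.
move=> a0 M0; have [C0 C00 hC0] := rates_le_rate a0.
set b := Num.min a 1 in hC0.
have hb : 0 < b <= 1 by rewrite lt_min a0 ltr01 ge_min lexx orbT.
set l : R := ln (2 * (Num.truncn M).+2).+1%:R.
have l0 : 0 <= l by apply: ln_ge0; rewrite ler1n.
pose C1 := 6 * (1 + 2 * M) ^+ 2 + 640 + 512 * l.
have C10 : 0 < C1.
  have := sqr_ge0 (1 + 2 * M); rewrite /C1; lra.
exists (C1 * C0) => [|n n2]; first exact: mulr_gt0.
have n0 : (0 < n)%N by lia.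
have n0R : 0 < n%:R :> R by rewrite ltr0n.
have [K [_ k2n k2 e2 _]] := balanced_grid hb n0.
have [that hthat] := net_least_squares_risk n K a0 (ltW M0).
apply: (minimax_risk_le (that := that)) => f xi hf hxi.
apply: le_trans (hthat f xi hf hxi) _; rewrite -/b -/l.
rewrite -mulrA; apply: le_trans (ler_wpM2l (ltW C10) (hC0 n n2)).
rewrite ler_pdivrMl ?exprn_gt0 //.
set k := K.+1%:R in k2n k2 e2 *; set e := k `^ (- b) in e2 *; set rho := smooth_rate b n in k2 e2 *.
have n2R : 2 <= n%:R :> R by rewrite ler_nat.
have k1 : 1 <= k by rewrite /k ler1n.
have lnn0 : 0 <= ln n%:R :> R by have := ln_nat_ge_half R n2; lra.
have lk : ln k <= 2 * ln n%:R.
  have k0 : 0 < k by apply: lt_le_trans k1.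
  rewrite mulr_natl -lnXn // ler_ln ?posrE ?exprn_gt0 //.
  by rewrite expr2; nra.
have lk1 : ln K.+2%:R <= 3 * ln n%:R :> R.
  rewrite mulr_natl -lnXn // ler_ln ?posrE ?exprn_gt0 ?ltr0n //.
  rewrite -natr1 -/k !exprS expr0 mulr1; nra.
have -> : n%:R ^+ 2 * (C1 * (rho + ln n%:R / n%:R)) =
    C1 * (n%:R ^+ 2 * rho) + C1 * (n%:R * ln n%:R) by field; rewrite gt_eqF.
rewrite !exprMn; set N2 := n%:R ^+ 2 in k2 *; set m := (1 + 2 * M) ^+ 2.
have N20 : 0 < N2 by rewrite exprn_gt0.
have m0 : 0 <= m by apply: sqr_ge0.
have rho0 : 0 <= N2 * rho by rewrite mulr_ge0 ?powR_ge0 // ltW.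
have nl0 : 0 <= n%:R * ln n%:R :> R by rewrite mulr_ge0.
have h1 : N2 * (m * e ^+ 2) <= m * (N2 * rho).
  by rewrite mulrCA; apply: ler_wpM2l => //; rewrite ler_pM2l.
have h2 : k ^+ 2 * l <= 4 * l * (N2 * rho).
  by rewrite [leRHS]mulrAC; apply: ler_wpM2r.
have h3 : n%:R * ln k <= 2 * (n%:R * ln n%:R).
  by rewrite mulrCA ler_pM2l.
have h4 : ln K.+2%:R <= 3 * (n%:R * ln n%:R) :> R.
  apply: le_trans lk1 _; rewrite ler_pM2l // ler_peMl //; lra.
have h5 : 0 <= m * (n%:R * ln n%:R) by apply: mulr_ge0.
have h6 : 0 <= l * (n%:R * ln n%:R) by apply: mulr_ge0.
have -> : C1 = 6 * m + 640 + 512 * l by [].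
set X := N2 * rho in h1 h2 rho0 *; set Y := n%:R * ln n%:R in nl0 h3 h4 h5 h6 *.
lra.
Qed.

(** * The lower bound below smoothness 1 *)

Lemma card_residue_class n k (a : nat) : (0 < k)%N ->
  (#|[pred i : 'I_n | (i %% k)%N == a]| <= (n %/ k).+1)%N.
Proof.
move=> k0; rewrite -[X in (_ <= X)%N]card_ord.
pose q (i : 'I_n) : 'I_(n %/ k).+1 := inord (i %/ k).
apply: (@leq_card_in _ _ q) => i j /eqP hi /eqP hj.
have qE (x : 'I_n) : q x = (x %/ k)%N :> nat.
  by rewrite inordK // ltnS leq_div2r // ltnW.
move=> /(congr1 val); rewrite /= !qE => hq; apply: val_inj => /=.
by rewrite (divn_eq i k) (divn_eq j k) hq hi hj.
Qed.

Section Bumps.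
Variables (R : realType) (K : nat).
Local Notation k := (K.+1%:R : R).
Local Notation vertex := {ffun 'I_K.+1 * 'I_K.+1 -> bool}.

Definition bump_center (u w : nat) : R * R := (u%:R / (2 * k), w%:R / (2 * k)).

(** Each tent vanishes at the other centres; taking a maximum, instead of a
    sum, makes the Lipschitz bound immediate.  The first coordinates of the
    centres are at least 1/2 and the second ones are smaller, so that pairs of
    nodes on the same side of 1/2 see no tent. *)
Definition bumps (z : vertex) (p : R * R) : R :=
  \big[Num.max/0]_(ab | z ab)
     (1 - 2 * k * dist1 p (bump_center (K.+1 + ab.1) ab.2)).

Lemma dist1_triangle (p q r : R * R) : dist1 p r <= dist1 p q + dist1 q r.
Proof.
rewrite /dist1; have := ler_distD q.1 p.1 r.1; have := ler_distD q.2 p.2 r.2; lra.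
Qed.

Lemma dist1C (p q : R * R) : dist1 p q = dist1 q p.
Proof. by rewrite /dist1 distrC [`|p.2 - _|]distrC. Qed.

Lemma bumps01 z p : 0 <= bumps z p <= 1.
Proof.
rewrite /bumps; apply/andP; split; first exact: bigmax_ge_id.
apply: bigmax_le => // ab _; rewrite gerBl mulr_ge0 ?dist1_ge0 //.
Qed.

Lemma bumps_lipschitz z p q : `|bumps z p - bumps z q| <= 2 * k * dist1 p q.
Proof.
have H x y : bumps z x <= bumps z y + 2 * k * dist1 x y.
  apply: bigmax_le => [|ab zab].
    by have /andP[? _] := bumps01 z y; rewrite addr_ge0 // mulr_ge0 ?dist1_ge0.
  apply: (@le_trans _ _ (1 - 2 * k * dist1 y (bump_center (K.+1 + ab.1) ab.2) + 2 * k * dist1 x y)).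
    have k20 : 0 <= 2 * k by [].
    have := ler_wpM2l k20 (dist1_triangle y x (bump_center (K.+1 + ab.1) ab.2)).
    rewrite (dist1C y x); lra.
  rewrite lerD2r /bumps.
  exact: (le_bigmax_cond 0 (fun ab : 'I_K.+1 * 'I_K.+1 =>
    1 - 2 * k * dist1 y (bump_center (K.+1 + ab.1) ab.2)) (j := ab)).
have := H p q; have := H q p; rewrite (dist1C q p) => h1 h2.
by rewrite ler_norml; apply/andP; split; lra.
Qed.

Lemma bumps_grid z (u w : nat) :
  bumps z (bump_center u w) =
  [exists ab, [&& z ab, (K.+1 + ab.1)%N == u & ab.2 == w :> nat]]%:R.
Proof.
have k0 : 0 < k by rewrite ltr0n.
have k20 : 0 < 2 * k by rewrite mulr_gt0.
have nat_dist (x y : nat) : x != y -> 1 <= `|x%:R - y%:R| :> R.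
  move=> xy; have [h|h|h] := ltngtP x y; last by rewrite h eqxx in xy.
    by rewrite distrC -natrB ?(ltnW h) // normr_nat ler1n subn_gt0.
  by rewrite -natrB ?(ltnW h) // normr_nat ler1n subn_gt0.
have hd (u' w' : nat) : 2 * k * dist1 (bump_center u w) (bump_center u' w') =
    `|u%:R - u'%:R| + `|w%:R - w'%:R|.
  rewrite /dist1 /= -!mulrBl !normrM (ger0_norm (x := (2 * k)^-1)) ?invr_ge0 ?(ltW k20) //.
  by rewrite -mulrDl mulrC divfK // gt_eqF.
case: existsP => [[ab /and3P[zab /eqP hu /eqP hw]]|H]; apply/le_anti/andP; split.
- by have /andP[] := bumps01 z (bump_center u w).
- apply: le_trans (le_bigmax_cond _ _ zab); rewrite hd hu hw !subrr normr0 /=; lra.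
- apply: bigmax_le => // ab zab; rewrite hd [leRHS]/=.
  have [h|h] := eqVneq (K.+1 + ab.1)%N u; last first.
    have := nat_dist _ _ h; rewrite distrC; have := normr_ge0 (w%:R - ab.2%:R : R); lra.
  have [h'|h'] := eqVneq (ab.2 : nat) w.
    by case: H; exists ab; rewrite zab h h' !eqxx.
  have := nat_dist _ _ h'; rewrite distrC; have := normr_ge0 (u%:R - (K.+1 + ab.1)%:R : R); lra.
- by have /andP[] := bumps01 z (bump_center u w).
Qed.

Definition bump_graphon (c h : R) (z : vertex) (p : R * R) : R :=
  c + h * bumps z (if p.2 <= p.1 then p else (p.2, p.1)).

Lemma bump_graphon_holder (a M c h : R) (z : vertex) :
  0 < a < 1 -> 0 <= c -> 0 <= h -> c + h <= 1 -> c + h <= M / 2 ->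
  h * k `^ a <= M / 4 -> holder_class a M (bump_graphon c h z).
Proof.
move=> /andP[a0 a1] c0 h0 ch1 chM hk.
have B01 p := bumps01 z p.
have val01 p : 0 <= bump_graphon c h z p <= c + h.
  rewrite /bump_graphon; set q := (if _ then _ else _).
  have /andP[b0 b1] := B01 q; apply/andP; split.
    by rewrite addr_ge0 // mulr_ge0.
  by rewrite lerD2l -[leRHS]mulr1; apply: ler_wpM2l.
split.
- by move=> p _; have /andP[-> hp] := val01 p; apply: le_trans hp ch1.
- move=> [x y] _; rewrite /bump_graphon /=; case: (ltgtP x y) => // ->; by [].
have t0 : Num.truncn a = 0%N by apply/truncn_def; rewrite ltW.
exists (fun _ _ => bump_graphon c h z); split; first by rewrite t0; split.
rewrite [M](_ : M = M / 2 + M / 2); last by lra.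
apply: holder_norm_le; rewrite t0.
  move=> _ _ p _ _; have /andP[h1 h2] := val01 p; rewrite ger0_norm //.
  exact: le_trans h2 chM.
move=> _ _ p q _ [_ tp] [_ tq] pq; rewrite subr0 /bump_graphon tp tq.
rewrite opprD addrACA subrr add0r -mulrBr normrM ger0_norm //.
have k0 : 0 < k by rewrite ltr0n.
set x := 2 * k * dist1 p q; have x0 : 0 <= x by rewrite /x mulr_ge0 ?dist1_ge0.
have step : `|bumps z p - bumps z q| <= x `^ a.
  have [x1|x1] := leP x 1.
    apply: le_trans (bumps_lipschitz z p q) _; rewrite -/x.
    have [->|xn0] := eqVneq x 0; first exact: powR_ge0.
    by apply: ger1_powR; rewrite ?(ltW a1) // x1 lt_neqAle eq_sym xn0 x0.
  apply: (@le_trans _ _ 1).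
    have /andP[? ?] := B01 p; have /andP[? ?] := B01 q.
    by rewrite ler_norml; apply/andP; split; lra.
  by rewrite -(powRr0 x); apply: ler_powR; rewrite ltW.
apply: le_trans (ler_wpM2l h0 step) _.
rewrite /x !powRM ?mulr_ge0 ?dist1_ge0 ?(ltW k0) //.
rewrite mulrA; apply: ler_wpM2r; first exact: powR_ge0.
have h2 : 2 `^ a <= 2 :> R by apply: ler1_powR; rewrite ?ler1n // ltW.
rewrite mulrCA; apply: le_trans (_ : 2 * (M / 4) <= _); last by lra.
by apply: ler_pM; rewrite ?powR_ge0 ?mulr_ge0 ?powR_ge0.
Qed.

(** The second half of the nodes is spread over [1/2, 1], the first half over
    [0, 1/2]; nodes with the same residue share a position. *)
Definition bump_index n (i : nat) : nat :=
  if (i < n./2)%N then (i %% K.+1)%N else (K.+1 + i %% K.+1)%N.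

Definition bump_nodes n : n.-tuple (measurableTypeR R) :=
  [tuple ((bump_index n i)%:R / (2 * k) : R) | i < n].

Lemma bump_nodes_cube n : unit_cube (bump_nodes n).
Proof.
move=> i; rewrite tnth_mktuple; apply/andP; split.
  by rewrite divr_ge0.
rewrite ler_pdivrMr ?mulr_gt0 // mul1r -natrM ler_nat /bump_index.
by have := ltn_pmod i (ltn0Sn K); case: ifP; lia.
Qed.

Definition bump_cell n (p : 'I_n * 'I_n) : 'I_K.+1 * 'I_K.+1 :=
  (inord (p.1 %% K.+1), inord (p.2 %% K.+1)).

Lemma bump_edge_prob n (c h : R) z (p : 'I_n * 'I_n) : lower p ->
  edge_prob (bump_graphon c h z) (bump_nodes n) p.1 p.2 =
  c + h * (crossing p && z (bump_cell p))%:R.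
Proof.
move=> lp; have lp' : (p.2 < p.1)%N by [].
rewrite mxE ifN; last by rewrite -val_eqE /= neq_ltn lp' orbT.
rewrite !tnth_mktuple /bump_graphon /=; congr (_ + _ * _).
have k20 : 0 < 2 * k by rewrite mulr_gt0 // ltr0n.
have m1 := ltn_pmod p.1 (ltn0Sn K); have m2 := ltn_pmod p.2 (ltn0Sn K).
rewrite ler_pM2r ?invr_gt0 // ler_nat.
have -> : (if (bump_index n p.2 <= bump_index n p.1)%N
           then ((bump_index n p.1)%:R / (2 * k), (bump_index n p.2)%:R / (2 * k))
           else ((bump_index n p.2)%:R / (2 * k), (bump_index n p.1)%:R / (2 * k))) =
  bump_center (maxn (bump_index n p.1) (bump_index n p.2))
              (minn (bump_index n p.1) (bump_index n p.2)).
  by rewrite /bump_center; case: leqP => h'; rewrite ?(maxn_idPl h') ?(minn_idPr h') ?(maxn_idPr (ltnW h')) ?(minn_idPl (ltnW h')).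
rewrite bumps_grid; congr (_%:R); congr nat_of_bool.
rewrite /crossing /bump_index; case: (ltnP p.2 n./2) => h2 /=; last first.
  rewrite ltnNge (leq_trans h2 (ltnW lp')) /=; apply/negbTE/existsPn => -[x y] /=.
  by apply/negP => /and3P[_ /eqP e1 /eqP e2]; have := ltn_ord y; lia.
case: (leqP n./2 p.1) => h1 /=; last first.
  apply/negbTE/existsPn => -[x y] /=.
  by apply/negP => /and3P[_ /eqP e1 /eqP e2]; lia.
rewrite (maxn_idPl _) ?(minn_idPr _); try lia.
apply/existsP/idP => [[[x y] /= /and3P[zxy /eqP e1 /eqP e2]]|zc].
  rewrite /bump_cell -e2 (_ : (p.1 %% K.+1)%N = x); last by lia.
  by rewrite !inord_val.
by exists (bump_cell p); rewrite zc /= !inordK // !eqxx.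
Qed.

End Bumps.

(** Below smoothness 1: the values of the function on a grid of [k] by [k]
    cells are hard to estimate, even with known positions of the nodes. *)
Lemma minimax_lower_bound_rough (R : realType) (a M : R) : 0 < a < 1 -> 0 < M ->
  exists2 c : R, 0 < c & forall n, (2 <= n)%N ->
    ((c * rate a n)%:E <= minimax_risk n a M)%E.
Proof.
move=> a01 M0; have /andP[a0 a1] := a01.
(* A quarter of the norm is spent on the constant, which leaves room for the
   bumps. *)
pose c0 := Num.min (1 / 2) (M / 4).
have c00 : 0 < c0 by rewrite lt_min; apply/andP; split; lra.
have c0h : c0 <= 1 / 2 by rewrite ge_min lexx.
have c0M : c0 <= M / 4 by rewrite ge_min lexx orbT.
exists ((c0 / 8) ^+ 2 / 256); first by rewrite divr_gt0 // exprn_gt0 // divr_gt0.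
move=> n n2; have n0 : (0 < n)%N by lia.
have ha : 0 < a <= 1 by rewrite a0 ltW.
have [K [nk _ _ _ re]] := balanced_grid ha n0.
set k := K.+1%:R in nk re; set e := k `^ (- a) in re.
have k1 : 1 <= k by rewrite /k ler1n.
have k0 : 0 < k by apply: lt_le_trans k1.
have e0 : 0 < e by apply: powR_gt0.
have ek : e * k `^ a = 1 by rewrite /e powRN mulVf // gt_eqF // powR_gt0.
have e1 : e <= 1.
  rewrite -ek -[leLHS]mulr1 ler_pM2l // -(powRr0 k); apply: ler_powR => //; exact: ltW.
(* The largest amplitude that smoothness allows; a cell then contains about
   [e^-2] pairs of nodes, too few to detect it. *)
pose h : R := c0 / 8 * e.
have hk : h * k `^ a = c0 / 8 by rewrite /h -[LHS]mulrA ek mulr1.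
have h0 : 0 < h by rewrite mulr_gt0 // divr_gt0.
have hc : h <= c0 / 8 by rewrite -[leRHS]mulr1 ler_pM2l // divr_gt0.
apply: minimax_risk_ge => that.
pose f (z : {ffun 'I_K.+1 * 'I_K.+1 -> bool}) : R * R -> R := bump_graphon c0 h z.
have fH (z : {ffun 'I_K.+1 * 'I_K.+1 -> bool}) : holder_class a M (f z).
  apply: bump_graphon_holder => //; [exact: ltW|exact: ltW|lra|lra|].
  by rewrite -/k hk; lra.
have hxi := @bump_nodes_cube R K n.
pose theta z := edge_prob (f z) (bump_nodes R K n).
have f01 z p : square p -> 0 <= f z p <= 1 by have [H _ _] := fH z; apply: H.
have thE z p : lower p -> theta z p.1 p.2 = c0 + h * (crossing p && z (bump_cell K p))%:R.
  exact: bump_edge_prob.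
have [z hz] : exists z, h ^+ 2 / 64 <= matrix_risk that (theta z).
  apply: (@assouad R n _ theta (@bump_cell K n) (c0 / 4)) => //.
  - by lra.
  - exact: sqr_ge0.
  - by move=> z i j; apply: (edge_prob01 (f01 z)).
  - by move=> z p lp; rewrite thE //; case: (crossing p && _); rewrite /= ?mulr0 ?mulr1; (split; [apply/andP; split|]); nra.
  - move=> z i; rewrite /sqdist.
    pose S : pred ('I_n * 'I_n) := fun p => lower p && (bump_cell K p == i).
    apply: (@le_trans _ _ (\sum_(p | S p) h ^+ 2)).
      rewrite [leLHS](bigID (fun p => bump_cell K p == i)) /= [X in _ + X]big1 ?addr0.
        apply: ler_sum => p /andP[lp _]; rewrite !thE //.
        by case: (crossing p && _); case: (crossing p && _); rewrite /= ?mulr0 ?mulr1; nra.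
      by move=> p /andP[lp /negbTE hp]; rewrite !thE // ffunE hp subrr expr0n.
    rewrite sumr_const -[leLHS]mulr_natl.
    have card_S : (#|S| <= (n %/ K.+1).+1 ^ 2)%N.
      rewrite expnS expn1; apply: leq_trans (leq_mul (card_residue_class n i.1 (ltn0Sn K)) (card_residue_class n i.2 (ltn0Sn K))).
      rewrite -cardX; apply: subset_leq_card; apply/fintype.subsetP => -[x y].
      rewrite !inE /in_mem /= => /andP[_ /eqP <-] /=.
      by rewrite !inordK ?ltn_pmod // !eqxx.
    have hq : (n %/ K.+1).+1%:R * e <= 2.
      have : (n %/ K.+1)%:R * k <= k * k `^ a.
        by apply: le_trans nk; rewrite -natrM ler_nat leq_trunc_div.
      rewrite mulrC ler_pM2l // => hq; have := ler_wpM2l (ltW e0) hq.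
      by rewrite ek -natr1; lra.
    have hq0 : 0 <= (n %/ K.+1).+1%:R * e by rewrite mulr_ge0 // ltW.
    apply: (@le_trans _ _ ((n %/ K.+1).+1%:R ^+ 2 * h ^+ 2)).
      by apply: ler_wpM2r; [exact: sqr_ge0 | rewrite -natrX ler_nat].
    rewrite -exprMn /h mulrCA exprMn.
    have hq2 : ((n %/ K.+1).+1%:R * e) ^+ 2 <= 2 ^+ 2 by apply: lerXn2r; rewrite ?nnegrE.
    apply: le_trans (ler_wpM2l (sqr_ge0 (c0 / 8)) hq2) _; nra.
  - move=> z p cp; rewrite !thE ?(crossing_lower cp) // cp /= ffunE eqxx.
    by case: (z _); rewrite /= ?mulr0 ?mulr1; nra.
exists (f z), (bump_nodes R K n); split=> //; apply: le_trans hz.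
rewrite /rate a1 /h exprMn; have := ler_wpM2l (sqr_ge0 (c0 / 8)) re.
rewrite /smooth_rate; lra.
Qed.

(** * A smooth wave *)

Section Oscillation.
Variables (R : realType) (w : R).

Lemma cos_lipschitz (u v : R) : `|cos u - cos v| <= `|u - v|.
Proof.
have H (a b : R) : a <= b -> `|cos b - cos a| <= b - a.
  move=> ab; have [|c _ ->] := @MVT_segment R cos (fun x => - sin x) a b ab _ _.
  - exact: continuous_subspaceT (@continuous_cos R).
  rewrite normrM normrN [`|b - a|]ger0_norm ?subr_ge0 //.
  by rewrite ler_piMl ?subr_ge0 // sin_max.
have [uv|/ltW uv] := leP u v; last by rewrite [leRHS]ger0_norm ?subr_ge0 //; apply: H.
by rewrite distrC [leRHS]distrC [leRHS]ger0_norm ?subr_ge0 //; apply: H.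
Qed.

(** [wave_deriv j p q] is the [j]-th derivative in [x] of
    [x^p * cos (w x y + q pi / 2)]; since the derivative of this family stays
    in its span, no closed formula is needed. *)
Fixpoint wave_deriv (j p q : nat) (x y : R) : R :=
  if j is j'.+1 then
    p%:R * wave_deriv j' p.-1 q x y + w * y * wave_deriv j' p q.+1 x y
  else x ^+ p * cos (w * x * y + q%:R * (pi / 2)).

Lemma cos_shift_derive (q : nat) (a b : R) (x : R) :
  is_derive x 1 (fun x => cos (a * x + b + q%:R * (pi / 2)))
    (a * cos (a * x + b + q.+1%:R * (pi / 2))).
Proof.
have -> : a * x + b + q.+1%:R * (pi / 2) = (a * x + b + q%:R * (pi / 2)) + pi / 2.
  by rewrite -natr1; ring.
rewrite cosDpihalf [a * - _]mulrC.
have h : is_derive x 1 (fun x => a * x + b + q%:R * (pi / 2)) a.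
  by apply: is_derive_eq; rewrite ?addr0 ?add0r ?scaler0 ?addr0 ?add0r ?mulr1 // /GRing.scale /= ?mulr1 ?mulr0 ?add0r ?addr0.
exact: (@is_derive1_comp R cos (fun x => a * x + b + q%:R * (pi / 2)) x _ _
  (is_derive_cos _) h).
Qed.

Lemma wave_deriv_derive (j p q : nat) (x y : R) :
  is_derive x 1 (fun x : R => wave_deriv j p q x y) (wave_deriv j.+1 p q x y).
Proof.
elim: j p q => [|j IH] p q.
  have hc : is_derive x 1 (fun x => cos (w * x * y + q%:R * (pi / 2)))
      (w * y * cos (w * x * y + q.+1%:R * (pi / 2))).
    have -> : (fun x : R => cos (w * x * y + q%:R * (pi / 2))) =
        (fun x : R => cos (w * y * x + 0 + q%:R * (pi / 2))).
      by apply: funext => t; rewrite addr0 mulrAC.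
    apply: (is_derive_eq (cos_shift_derive q (w * y) 0 x)).
    by rewrite addr0 [w * y * x]mulrAC.
  have hp : is_derive x 1 (fun x : R => x ^+ p) (p%:R * x ^+ p.-1).
    have -> : (fun x : R => x ^+ p) = (id : R -> R) ^+ p by apply/funext => t; rewrite exprfctE.
    apply: (is_derive_eq (is_deriveX p (is_derive_id x (1 : R)))).
    by rewrite /GRing.scale /= mulr1.
  have := is_deriveM hp hc; rewrite /GRing.scale /= => h.
  by apply: (is_derive_eq h); ring.
have h1 := is_deriveZ p%:R (IH p.-1 q); have h2 := is_deriveZ (w * y) (IH p q.+1).
exact: is_deriveD h1 h2.
Qed.

Lemma is_derive_within_quotient (g : R -> R) (x dg : R) (A : set R) :
  is_derive x 1 g dg ->
  h^-1 * (g (x + h) - g x) @[h --> within A 0^'] --> dg.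
Proof.
move=> hg; apply: (@within_subset_cvg _ _ (0 : R)^' _ A setT) => //.
have hq : h^-1 *: (g (h *: 1 + x) - g x) @[h --> 0^'] --> dg.
  have /cvg_ex[l hl] := @ex_derive _ _ _ _ _ _ _ hg.
  have <- : l = dg by rewrite -(@derive_val _ _ _ _ _ _ _ hg); apply/esym/cvg_lim.
  exact: hl.
move=> P /hq hP; change ((0 : R)^' [set h | setT h -> P (h^-1 * (g (x + h) - g x))]).
have {hP} : (0 : R)^' [set h | P (h^-1 *: (g (h *: 1 + x) - g x))] by exact: hP.
apply: filterS => h /= hP _; move: hP.
by rewrite [h *: 1]mulr1 [h + x]addrC.
Qed.

Lemma expr_lipschitz (p : nat) (x y : R) : 0 <= x <= 1 -> 0 <= y <= 1 ->
  `|x ^+ p - y ^+ p| <= p%:R * `|x - y|.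
Proof.
move=> hx hy; elim: p => [|p IH]; first by rewrite !expr0 subrr normr0 mul0r.
have /andP[x0 x1] := hx; have /andP[y0 y1] := hy.
rewrite !exprS (_ : _ - _ = x * (x ^+ p - y ^+ p) + (x - y) * y ^+ p); last by ring.
apply: le_trans (ler_normD _ _) _; rewrite -natr1 [leRHS]mulrDl mul1r !normrM; apply: lerD.
  by apply: le_trans IH; rewrite ler_piMl // ger0_norm.
rewrite ler_piMr // ger0_norm ?exprn_ge0 //; exact: exprn_ile1.
Qed.

Lemma wave_deriv_bound j p q x y : 1 <= w -> 0 <= x <= 1 -> 0 <= y <= 1 ->
  `|wave_deriv j p q x y| <= (p%:R + w) ^+ j.
Proof.
move=> w1 hx hy; have /andP[x0 x1] := hx; have /andP[y0 y1] := hy.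
elim: j p q => [|j IH] p q.
  rewrite /= normrM expr0; apply: mulr_ile1 => //; last exact: cos_max.
  by rewrite ger0_norm ?exprn_ge0 //; apply: exprn_ile1.
have w0 : 0 <= w := le_trans ler01 w1.
rewrite /= exprS [leRHS]mulrDl; apply: le_trans (ler_normD _ _) _; apply: lerD.
  rewrite normrM ger0_norm //; apply: ler_wpM2l => //.
  apply: le_trans (IH _ _) _; apply: lerXn2r; rewrite ?nnegrE ?addr_ge0 //.
  by rewrite lerD2r ler_nat leq_pred.
rewrite !normrM (ger0_norm w0) (ger0_norm y0) -mulrA; apply: ler_wpM2l => //.
by apply: le_trans (IH p q.+1); rewrite ler_piMl.
Qed.

Lemma wave_deriv_lipschitz j p q x y x' y' : 1 <= w ->
  0 <= x <= 1 -> 0 <= y <= 1 -> 0 <= x' <= 1 -> 0 <= y' <= 1 ->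
  `|wave_deriv j p q x y - wave_deriv j p q x' y'| <=
    j.+1%:R * (p%:R + w) ^+ j.+1 * (`|x - x'| + `|y - y'|).
Proof.
move=> w1 hx hy hx' hy'; have /andP[x0 x1] := hx; have /andP[y0 y1] := hy.
have /andP[x0' x1'] := hx'; have /andP[y0' y1'] := hy'.
have w0 : 0 <= w := le_trans ler01 w1.
set d := _ + `|y - y'|; have d0 : 0 <= d by rewrite addr_ge0.
elim: j p q => [|j IH] p q.
  rewrite /= mul1r expr1.
  set c := cos _; set c' := cos _.
  rewrite (_ : _ - _ = (x ^+ p - x' ^+ p) * c + x' ^+ p * (c - c')); last by ring.
  apply: le_trans (ler_normD _ _) _; rewrite [leRHS]mulrDl !normrM; apply: lerD.
    apply: (@le_trans _ _ `|x ^+ p - x' ^+ p|); first by rewrite ler_piMr // cos_max.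
    apply: le_trans (expr_lipschitz p hx hx') _; apply: ler_wpM2l => //.
    by rewrite lerDl.
  apply: (@le_trans _ _ `|c - c'|).
    by rewrite ler_piMl // ger0_norm ?exprn_ge0 // exprn_ile1.
  apply: le_trans (cos_lipschitz _ _) _.
  rewrite (_ : _ - _ = w * ((x - x') * y + x' * (y - y'))); last by ring.
  rewrite normrM (ger0_norm w0); apply: ler_wpM2l => //.
  apply: le_trans (ler_normD _ _) _; rewrite !normrM; apply: lerD.
    by rewrite ler_piMr // ger0_norm.
  by rewrite ler_piMl // ger0_norm.
set E := wave_deriv j; set B := p%:R + w.
have B1 : 1 <= B by rewrite /B; have := ler0n R p; lra.
rewrite /= -/E (_ : _ - _ = p%:R * (E p.-1 q x y - E p.-1 q x' y') +
  (w * y * (E p q.+1 x y - E p q.+1 x' y') + w * ((y - y') * E p q.+1 x' y'))); last by ring.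
have h1 : `|p%:R * (E p.-1 q x y - E p.-1 q x' y')| <= p%:R * (j.+1%:R * B ^+ j.+1 * d).
  rewrite normrM ger0_norm //; apply: ler_wpM2l => //.
  apply: le_trans (IH _ _) _; apply: ler_wpM2r => //; apply: ler_wpM2l => //.
  apply: lerXn2r; rewrite ?nnegrE ?addr_ge0 // /B.
  by rewrite lerD2r ler_nat leq_pred.
have h2 : `|w * y * (E p q.+1 x y - E p q.+1 x' y')| <= w * (j.+1%:R * B ^+ j.+1 * d).
  rewrite !normrM (ger0_norm w0) (ger0_norm y0) -mulrA; apply: ler_wpM2l => //.
  by apply: le_trans (IH p q.+1); rewrite ler_piMl.
have h3 : `|w * ((y - y') * E p q.+1 x' y')| <= B ^+ j.+2 * d.
  rewrite exprS -mulrA normrM (ger0_norm w0); apply: ler_pM => //.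
    by rewrite /B lerDr.
  rewrite normrM mulrC; apply: ler_pM => //; last by rewrite /d lerDr.
  apply: le_trans (wave_deriv_bound j p q.+1 w1 hx' hy') _.
  by rewrite exprS ler_peMl // exprn_ge0 // ltW // (lt_le_trans ltr01).
apply: le_trans (ler_normD _ _) _; apply: le_trans (lerD h1 (ler_normD _ _)) _.
apply: le_trans (lerD (lexx _) (lerD h2 h3)) _.
have pB : p%:R = B - w by rewrite /B addrK.
rewrite pB -[j.+2%:R]natr1 (exprS B j.+1); move: (B ^+ j.+1) (j.+1%:R : R) => Y L.
by rewrite le_eqVlt; apply/orP; left; apply/eqP; ring.
Qed.

(** The wave [c + h cos (w x y)], whose slices in [x] at the heights [y]
    oscillate at frequencies proportional to [y]: it lets one node read the
    digits of the position of another. *)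
Definition wave_graphon (c h : R) (p : R * R) : R := c + h * cos (w * p.1 * p.2).

Definition wave_partials (c h : R) (j k : nat) (p : R * R) : R :=
  (if (j + k == 0)%N then c else 0) + h * (w ^+ k * wave_deriv j k k p.1 p.2).

Lemma wave_partialsP (c h : R) m : partials m (wave_graphon c h) (wave_partials c h).
Proof.
split=> [[x y] _|k [x y] _ _|j k [x y] _ _].
- by rewrite /wave_partials /wave_graphon /= !expr0 !mul1r mul0r addr0.
- apply: (is_derive_within_quotient (g := fun t => wave_partials c h 0 k (x, t))).
  rewrite /wave_partials /=.
  set b := if _ then _ else _.
  have -> : (fun t => b + h * (w ^+ k * (x ^+ k * cos (w * x * t + k%:R * (pi / 2))))) =
    (cst b + ((h * w ^+ k * x ^+ k) \*: (fun t : R => cos (w * x * t + 0 + k%:R * (pi / 2))))).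
    by apply: funext => t; rewrite /= addrfctE /= /GRing.scale /= addr0 -!mulrA.
  have hc := cos_shift_derive k (w * x) 0 y.
  apply: (is_derive_eq (is_deriveD (is_derive_cst b y 1) (is_deriveZ (h * w ^+ k * x ^+ k) hc))).
  by rewrite /GRing.scale /= !add0r addr0 !exprS; ring.
- apply: (is_derive_within_quotient (g := fun t => wave_partials c h j k (t, y))).
  rewrite /wave_partials -/wave_deriv.
  set b := if (j + k == 0)%N then _ else _.
  have -> : (fun t => b + h * (w ^+ k * wave_deriv j k k (t, y).1 (t, y).2)) =
    (cst b + ((h * w ^+ k) \*: (fun t : R => wave_deriv j k k t y))).
    by apply: funext => t; rewrite /= addrfctE /= /GRing.scale /= -!mulrA.
  have hc := wave_deriv_derive j k k x y.
  apply: (is_derive_eq (is_deriveD (is_derive_cst b x 1) (is_deriveZ (h * w ^+ k) hc))).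
  by rewrite /GRing.scale addSn /= !add0r -!mulrA.
Qed.

(** The Hoelder norm of the wave is controlled by its amplitude times the
    power [1 + integer part] of its frequency; that power is not sharp, but
    only the ratio of logarithms of frequency and amplitude matters. *)
Lemma wave_graphon_holder (a M c h : R) :
  1 <= w -> 0 < a -> 0 <= h -> 0 <= c - h -> c + h <= 1 -> c <= M / 4 ->
  let m := Num.truncn a in
  h * (2 * m.+1%:R * (m%:R + w) ^+ m.+1) <= M / 4 ->
  holder_class a M (wave_graphon c h).
Proof.
move=> w1 a0 h0 ch ch1 cM m hM.
have c0 : 0 <= c by lra.
have mw1 : 1 <= m%:R + w by have := ler0n R m; lra.
split.
- move=> p _; rewrite /wave_graphon; have := cos_max (w * p.1 * p.2).
  rewrite ler_norml => /andP[l1 l2].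
  have u1 := ler_wpM2l h0 l1; have u2 := ler_wpM2l h0 l2.
  by apply/andP; split; lra.
- by move=> [x y] _; rewrite /wave_graphon /= mulrAC.
exists (wave_partials c h); split; first exact: wave_partialsP.
have pw k : (k <= m)%N -> 0 <= k%:R + w /\ k%:R + w <= m%:R + w.
  by move=> km; rewrite lerD2r ler_nat; split=> //; have := ler0n R k; lra.
have ww : 0 <= w /\ w <= m%:R + w by have := ler0n R m; split; lra.
rewrite [M](_ : M = M / 2 + M / 2); last by lra.
have mw0 (i : nat) : 0 <= (m%:R + w) ^+ i by rewrite exprn_ge0 //; lra.
apply: holder_norm_le => [j k [x y] jk [[/= hx hy] _]|j k [x y] [x' y'] jk [[/= hx hy] _] [[/= hx' hy'] _] pq].
  have km : (k <= m)%N by exact: leq_trans (leq_addl j k) jk.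
  rewrite /wave_partials; apply: le_trans (ler_normD _ _) _.
  have -> : M / 2 = M / 4 + M / 4 by lra.
  apply: lerD; first by case: ifP => _; rewrite ?ger0_norm ?normr0 //; lra.
  rewrite normrM (ger0_norm h0); apply: le_trans hM; apply: ler_wpM2l => //.
  rewrite normrM (ger0_norm (exprn_ge0 _ ww.1)).
  apply: (@le_trans _ _ ((m%:R + w) ^+ k * (m%:R + w) ^+ j)).
    apply: ler_pM => //; first by rewrite exprn_ge0 // ww.1.
      by apply: lerXn2r; rewrite ?nnegrE ?ww.1 ?ww.2 //; lra.
    apply: le_trans (wave_deriv_bound j k k w1 hx hy) _.
    by apply: lerXn2r; rewrite ?nnegrE ?(pw k km).1 ?(pw k km).2 //; lra.
  rewrite -exprD; apply: (@le_trans _ _ ((m%:R + w) ^+ m.+1)).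
    by apply: ler_weXn2l => //; rewrite addnC; exact: leqW.
  have m1 : 1 <= m.+1%:R :> R by rewrite ler1n.
  have : 1 <= 2 * m.+1%:R :> R by lra.
  by apply: ler_peMl.
have km : (k <= m)%N by rewrite /m -jk leq_addl.
rewrite /wave_partials opprD addrACA subrr add0r -!mulrBr /=.
set d := dist1 _ _; have d0 : 0 < d by apply: dist1_gt0.
have d2 : d <= 2.
  move: hx hy hx' hy' => /andP[? ?] /andP[? ?] /andP[? ?] /andP[? ?].
  rewrite /d /dist1 /= (_ : 2 = 1 + 1) //.
  by apply: lerD; rewrite ler_norml; apply/andP; split; lra.
(* On a set of diameter 2, Lipschitz implies Hoelder. *)
have ds : d <= 2 * d `^ (a - m%:R).
  rewrite -ler_pdivrMl // mulrC.
  have /andP[t1 t2] := truncn_itv (ltW a0).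
  apply: (@le_trans _ _ ((d / 2) `^ (a - m%:R))).
    by apply: ger1_powR; [apply/andP; split; lra | rewrite -natr1 -/m in t2; lra].
  by apply: ge0_ler_powR; rewrite ?nnegrE ?subr_ge0 //; lra.
rewrite normrM (ger0_norm h0) normrM (ger0_norm (exprn_ge0 _ ww.1)).
apply: (@le_trans _ _ (h * (m.+1%:R * (m%:R + w) ^+ m.+1 * d))).
  apply: ler_wpM2l => //.
  apply: (@le_trans _ _ ((m%:R + w) ^+ k * (m.+1%:R * (m%:R + w) ^+ j.+1 * d))).
    apply: ler_pM => //; first by rewrite exprn_ge0 // ww.1.
      by apply: lerXn2r; rewrite ?nnegrE ?ww.1 ?ww.2 //; lra.
    apply: le_trans (wave_deriv_lipschitz j k k w1 hx hy hx' hy') _.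
    apply: ler_wpM2r; first exact: ltW.
    apply: ler_pM => //; first by rewrite exprn_ge0 // (pw k km).1.
      by rewrite ler_nat ltnS /m -jk leq_addr.
    by apply: lerXn2r; rewrite ?nnegrE ?(pw k km).1 ?(pw k km).2 //; lra.
  have -> : (m%:R + w) ^+ m.+1 = (m%:R + w) ^+ k * (m%:R + w) ^+ j.+1.
    by rewrite -exprD addnS addnC jk.
  by rewrite le_eqVlt; apply/orP; left; apply/eqP; ring.
set X := _ ^+ m.+1 in hM *; set s := _ `^ _ in ds *.
have s0 : 0 <= s by apply: powR_ge0.
have X0 : 0 <= m.+1%:R * X by rewrite mulr_ge0 // mw0.
apply: (@le_trans _ _ (h * (m.+1%:R * X * (2 * s)))).
  by apply: ler_wpM2l => //; apply: ler_wpM2l.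
have -> : h * (m.+1%:R * X * (2 * s)) = h * (2 * m.+1%:R * X) * s by ring.
apply: ler_wpM2r => //; apply: le_trans hM _.
suff : 0 <= M / 4 by lra.
by apply: le_trans cM.
Qed.

End Oscillation.

(** * Reading binary words with a wave *)

Section BinaryCode.
Variables (R : realType) (r : nat).
Implicit Types (b : 'I_r -> bool) (u s : 'I_r).

(** The bits of a word, as digits 0 or 8 in base 16: a set bit is half a
    period of the wave that reads it. *)
Definition code b : nat := (\sum_(u < r) 8 * b u * 16 ^ u)%N.

(** Reading digit [u] of [m]: lower digits perturb the phase by at most
    [pi / 15], higher ones by multiples of [2 pi], while the digit itself
    contributes 0 or [pi]. *)
Definition slice (u m : nat) : R := cos (2 * pi * (m%:R / 16 ^+ u.+1)).

Lemma cos_periodic_nat (x : R) (n : nat) : cos (x + 2 * pi * n%:R) = cos x.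
Proof.
elim: n => [|n IH]; first by rewrite mulr0 addr0.
rewrite -[n.+1%:R]natr1 mulrDr mulr1 addrA -IH [2 * pi]mulr_natl; exact: cosD2pi.
Qed.

Lemma pi_le4 : pi <= 4 :> R.
Proof. by have := pihalf_02_cos_pihalf R => -[/andP[_ h] _]; lra. Qed.

Lemma pow16_gt0 (n : nat) : 0 < 16 ^+ n :> R.
Proof. by rewrite exprn_gt0. Qed.

Lemma code_set b b' s : b s = false -> (forall u, b' u = (u == s) (+) b u) ->
  code b' = (code b + 8 * 16 ^ s)%N.
Proof.
move=> bs hb'; rewrite /code (bigD1 s) //= [in RHS](bigD1 s) //= bs hb' eqxx bs.
rewrite muln0 mul0n add0n muln1 addnC; congr (_ + _)%N.
by apply: eq_bigr => u /negbTE us; rewrite hb' us.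
Qed.

Lemma slice_shift u s m : slice u (m + 8 * 16 ^ s)%N =
  cos (2 * pi * (m%:R / 16 ^+ u.+1) + pi * (16 ^+ s / 16 ^+ u)).
Proof.
rewrite /slice natrD natrM natrX; congr (cos _); rewrite exprS; field.
by rewrite !gt_eqF ?pow16_gt0.
Qed.

Lemma slice_set_dist b b' s u : b s = false ->
  (forall u, b' u = (u == s) (+) b u) ->
  (slice u (code b) - slice u (code b')) ^+ 2 <=
    if (s <= u)%N then 16 * 2^-1 ^+ (u - s) else 0.
Proof.
move=> bs hb'; rewrite (code_set bs hb') slice_shift.
case: leqP => [su|us]; last first.
  have -> : pi * (16 ^+ s / 16 ^+ u) = 2 * pi * (8 * 16 ^ (s - u).-1)%:R :> R.
    have -> : (s = u + (s - u).-1.+1 :> nat)%N by rewrite prednK ?subn_gt0 // subnKC // ltnW.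
    rewrite exprD exprS natrM natrX addKn /=; field.
    by rewrite gt_eqF ?pow16_gt0.
  by rewrite cos_periodic_nat subrr expr0n.
set x := 2 * pi * _.
have -> : 16 ^+ s / 16 ^+ u = 16^-1 ^+ (u - s) :> R.
  rewrite -{1}(subnKC su) exprD exprVn invfM mulrA divff ?mul1r // gt_eqF // pow16_gt0.
rewrite -real_normK ?num_real //.
have hl : `|cos x - cos (x + pi * 16^-1 ^+ (u - s))| <= 4 * 16^-1 ^+ (u - s).
  apply: le_trans (cos_lipschitz _ _) _; rewrite opprD addNKr normrN normrM.
  rewrite ger0_norm ?pi_ge0 // ger0_norm ?exprn_ge0 ?invr_ge0 //.
  by apply: ler_wpM2r pi_le4; rewrite exprn_ge0 ?invr_ge0.
apply: (@le_trans _ _ ((4 * 16^-1 ^+ (u - s)) ^+ 2)).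
  by apply: lerXn2r => //; rewrite nnegrE ?mulr_ge0 ?exprn_ge0 ?invr_ge0.
rewrite exprMn -exprM mulnC exprM (_ : 4 ^+ 2 = 16 :> R); last by lra.
rewrite ler_pM2l //; apply: lerXn2r; rewrite ?nnegrE ?exprn_ge0 ?invr_ge0 //.
by rewrite expr2; lra.
Qed.

Lemma geometric16 (n : nat) : (15 * (\sum_(u < n) 8 * 16 ^ u) <= 8 * 16 ^ n)%N.
Proof.
elim: n => [|n IH]; first by rewrite big_ord0 muln0.
rewrite big_ord_recr /= mulnDr expnS.
by move: (16 ^ n)%N (\sum_(_ < n) _)%N IH => X S; lia.
Qed.

Lemma slice_unset b s : b s = false -> 1 / 2 <= slice s (code b).
Proof.
move=> bs.
pose lo := (\sum_(u < r | u < s) 8 * b u * 16 ^ u)%N.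
have [hi hhi] : exists hi, (\sum_(u < r | s < u) 8 * b u * 16 ^ u = hi * 16 ^ s.+1)%N.
  apply/dvdnP; apply: dvdn_sum => u su.
  by apply: dvdn_mull; apply: dvdn_exp2l.
have codeE : code b = (hi * 16 ^ s.+1 + lo)%N.
  rewrite -hhi /code (bigID (fun u : 'I_r => (s < u)%N)) /=; congr (_ + _)%N.
  rewrite (bigD1 s) ?ltnn //= bs muln0 mul0n add0n.
  by apply: eq_bigl => u; rewrite -leqNgt ltn_neqAle andbC.
have lo15 : (15 * lo <= 8 * 16 ^ s)%N.
  apply: leq_trans (geometric16 s); rewrite leq_mul2l /=.
  rewrite (big_ord_widen r (fun u : nat => 8 * 16 ^ u)%N (ltnW (ltn_ord s))).
  apply: leq_sum => u _; rewrite leq_mul2r; apply/orP; right.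
  by case: (b u).
rewrite /slice codeE natrD natrM natrX.
have -> : 2 * pi * ((hi%:R * 16 ^+ s.+1 + lo%:R) / 16 ^+ s.+1) =
    2 * pi * (lo%:R / 16 ^+ s.+1) + 2 * pi * hi%:R :> R.
  by field; rewrite gt_eqF ?pow16_gt0.
rewrite cos_periodic_nat; set x := _ * (_ / _).
have x0 : 0 <= x by rewrite mulr_ge0 ?mulr_ge0 ?pi_ge0 ?invr_ge0 ?exprn_ge0.
have xs : x <= 1 / 2.
  rewrite /x exprS.
  have h : 15 * lo%:R <= 8 * 16 ^+ s :> R by rewrite -natrX -!natrM ler_nat.
  have h' : lo%:R / 16 ^+ s <= 8 / 15 :> R by rewrite ler_pdivrMr ?pow16_gt0 //; lra.
  have l0 : 0 <= lo%:R / 16 ^+ s :> R by rewrite mulr_ge0 ?invr_ge0 ?exprn_ge0.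
  have -> : 2 * pi * (lo%:R / (16 * 16 ^+ s)) = pi * (lo%:R / 16 ^+ s) / 8 :> R.
    by field; rewrite gt_eqF ?pow16_gt0.
  have := ler_pM (pi_ge0 R) l0 pi_le4 h'; lra.
have := cos_lipschitz 0 x; rewrite cos0 sub0r normrN (ger0_norm x0) => hc.
by have := ler_norm (1 - cos x); lra.
Qed.

Lemma slice_set_sep b b' s : b s = false ->
  (forall u, b' u = (u == s) (+) b u) ->
  1 <= (slice s (code b) - slice s (code b')) ^+ 2.
Proof.
move=> bs hb'; rewrite (code_set bs hb') slice_shift divff ?gt_eqF ?pow16_gt0 // mulr1.
rewrite cosDpi -/(slice s (code b)) opprK; have := slice_unset bs; nra.
Qed.

(** Setting and unsetting a bit are symmetric. *)
Lemma slice_flip b b' s : (forall u, b' u = (u == s) (+) b u) ->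
  1 <= (slice s (code b) - slice s (code b')) ^+ 2 /\
  forall u, (slice u (code b) - slice u (code b')) ^+ 2 <=
    if (s <= u)%N then 16 * 2^-1 ^+ (u - s) else 0.
Proof.
move=> hb'; case bs : (b s); last first.
  by split=> [|u]; [exact: slice_set_sep|exact: slice_set_dist].
have b's : b' s = false by rewrite hb' eqxx bs.
have hb u : b u = (u == s) (+) b' u by rewrite hb' addbA addbb.
by split=> [|u]; rewrite -sqrrN opprB; [exact: slice_set_sep|exact: slice_set_dist].
Qed.

Lemma code_le b : (code b <= 16 ^ r)%N.
Proof.
apply: leq_trans (_ : \sum_(u < r) 8 * 16 ^ u <= _)%N; last first.
  by have := geometric16 r; move: (16 ^ r)%N (\sum_(_ < r) _)%N => X S; lia.
by apply: leq_sum => u _; rewrite leq_mul2r; apply/orP; right; case: (b u).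
Qed.

Lemma geometric_half (s : nat) :
  \sum_(u < r) (if (s <= u)%N then 16 * 2^-1 ^+ (u - s) else 0) <= 32 :> R.
Proof.
suff : \sum_(u < r) (if (s <= u)%N then 16 * 2^-1 ^+ (u - s) else 0) <=
   32 - 32 * 2^-1 ^+ (r - s) :> R.
  have : 0 <= 2^-1 ^+ (r - s) :> R by rewrite exprn_ge0 ?invr_ge0.
  lra.
elim: r => [|n IH]; first by rewrite big_ord0 sub0n expr0; lra.
rewrite big_ord_recr /=; case: leqP => sn; last first.
  have -> : (n.+1 - s = 0)%N by lia.
  have ns : (n - s = 0)%N by lia.
  by move: IH; rewrite ns expr0; lra.
rewrite subSn // exprS; lra.
Qed.

End BinaryCode.

(** * The lower bound from unknown positions *)

Lemma wave_phase_cancel (R : realType) (x y t : R) : 0 < x -> 0 < y ->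
  2 * pi * x ^+ 2 * (t / x) * (x * y)^-1 = 2 * pi * (t / y).
Proof. by move=> x0 y0; field; rewrite !gt_eqF. Qed.

Section WaveNodes.
Variables (R : realType) (n r : nat).
Local Notation N := (16 ^+ r.+1 : R).
Local Notation vertex := {ffun 'I_n * 'I_r.+1 -> bool}.

Definition wave_freq : R := 2 * pi * N ^+ 2.

Definition node_code (z : vertex) (i : 'I_n) : nat := code (fun u => z (i, u)).

(** A node of the second half carries a word in its position; a node of the
    first half reads one digit of all words.  Two nodes of the second half see
    the wave at an integer multiple of its period, so that no information
    leaks from their edges. *)
Definition wave_nodes (z : vertex) : n.-tuple (measurableTypeR R) :=
  [tuple (if (i < n./2)%N then (N * 16 ^+ (i %% r.+1).+1)^-1
          else (node_code z i)%:R / N : R) | i < n].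

Definition wave_cell (p : 'I_n * 'I_n) : 'I_n * 'I_r.+1 := (p.1, inord (p.2 %% r.+1)).

Lemma wave_nodes_cube z : unit_cube (wave_nodes z).
Proof.
have N0 := pow16_gt0 R r.+1.
move=> i; rewrite tnth_mktuple; case: ifP => _; apply/andP; split.
- by rewrite invr_ge0 mulr_ge0 ?exprn_ge0.
- by rewrite invf_le1 ?mulr_gt0 ?pow16_gt0 // -exprD exprn_ege1 // ler1n.
- by rewrite divr_ge0 ?exprn_ge0.
- by rewrite ler_pdivrMr // mul1r -natrX ler_nat code_le.
Qed.

Lemma wave_edge_prob c h z (p : 'I_n * 'I_n) : lower p ->
  edge_prob (wave_graphon wave_freq c h) (wave_nodes z) p.1 p.2 =
  c + h * cos (wave_freq * tnth (wave_nodes z) p.1 * tnth (wave_nodes z) p.2).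
Proof.
move=> lp; have lp' : (p.2 < p.1)%N by [].
by rewrite mxE ifN // -val_eqE /= neq_ltn lp' orbT.
Qed.

Lemma wave_crossing c h z (p : 'I_n * 'I_n) : crossing p ->
  edge_prob (wave_graphon wave_freq c h) (wave_nodes z) p.1 p.2 =
  c + h * slice R (p.2 %% r.+1) (node_code z p.1).
Proof.
move=> cp; rewrite wave_edge_prob; last exact: crossing_lower.
have /andP[h2 h1] := cp; rewrite !tnth_mktuple h2 ltnNge h1 /= /slice /wave_freq.
by congr (_ + _ * cos _); apply: wave_phase_cancel; exact: pow16_gt0.
Qed.

Lemma wave_not_crossing c h z z' (p : 'I_n * 'I_n) : lower p -> ~~ crossing p ->
  edge_prob (wave_graphon wave_freq c h) (wave_nodes z) p.1 p.2 =
  edge_prob (wave_graphon wave_freq c h) (wave_nodes z') p.1 p.2.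
Proof.
move=> lp; rewrite !wave_edge_prob // !tnth_mktuple /crossing.
have lp' : (p.2 < p.1)%N by [].
case: (ltnP p.2 n./2) => h2; first by rewrite /= -ltnNge => ->.
move=> _; rewrite ltnNge (leq_trans h2 (ltnW lp')) /=.
have E (x y : nat) : cos (wave_freq * (x%:R / N) * (y%:R / N)) = 1.
  have -> : wave_freq * (x%:R / N) * (y%:R / N) = 0 + 2 * pi * (x * y)%:R.
    by rewrite /wave_freq natrM; field; rewrite gt_eqF ?pow16_gt0.
  by rewrite cos_periodic_nat cos0.
by rewrite !E.
Qed.

Lemma node_code_flip (z : vertex) (iu : 'I_n * 'I_r.+1) (i : 'I_n) :
  i != iu.1 -> node_code (flip iu z) i = node_code z i.
Proof.
move=> h; rewrite /node_code /code; apply: eq_bigr => u _; rewrite ffunE.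
by case: eqP => // e; rewrite -e eqxx in h.
Qed.

Lemma node_bits_flip (z : vertex) (iu : 'I_n * 'I_r.+1) (u : 'I_r.+1) :
  flip iu z (iu.1, u) = (u == iu.2) (+) z (iu.1, u).
Proof.
case: iu => i s; rewrite ffunE /= xpair_eqE eqxx /=.
by case: eqP => _; rewrite ?addTb ?addFb.
Qed.

Lemma wave_flip_sep c h z (p : 'I_n * 'I_n) : crossing p ->
  h ^+ 2 <= (edge_prob (wave_graphon wave_freq c h) (wave_nodes z) p.1 p.2 -
    edge_prob (wave_graphon wave_freq c h) (wave_nodes (flip (wave_cell p) z)) p.1 p.2) ^+ 2.
Proof.
move=> cp; rewrite !wave_crossing // opprD addrACA subrr add0r -mulrBr exprMn.
have [h1 _] := slice_flip R (node_bits_flip z (wave_cell p)).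
rewrite -[leLHS]mulr1; apply: ler_wpM2l; first exact: sqr_ge0.
by move: h1; rewrite /= inordK ?ltn_pmod.
Qed.

Lemma wave_flip_dist c h z (iu : 'I_n * 'I_r.+1) :
  sqdist (edge_prob (wave_graphon wave_freq c h) (wave_nodes z))
         (edge_prob (wave_graphon wave_freq c h) (wave_nodes (flip iu z)))
  <= 32 * h ^+ 2 * (n %/ r.+1).+1%:R.
Proof.
pose g (u : nat) : R := if (iu.2 <= u)%N then 16 * 2^-1 ^+ (u - iu.2) else 0.
have g0 u : 0 <= g u.
  by rewrite /g; case: ifP => // _; rewrite mulr_ge0 ?exprn_ge0 ?invr_ge0.
have [_ hg] := slice_flip R (node_bits_flip z iu).
apply: (@le_trans _ _ (\sum_(p : 'I_n * 'I_n | p.1 == iu.1) h ^+ 2 * g (p.2 %% r.+1)%N)).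
  rewrite /sqdist big_mkcond [leRHS]big_mkcond /=; apply: ler_sum => p _.
  case: ifP => lp; last by case: ifP => // _; rewrite mulr_ge0 ?sqr_ge0.
  have [cp|cp] := boolP (crossing p); last first.
    rewrite (wave_not_crossing c h z (flip iu z) lp cp) subrr expr0n /=.
    by case: ifP => // _; rewrite mulr_ge0 ?sqr_ge0.
  rewrite !wave_crossing // opprD addrACA subrr add0r -mulrBr exprMn.
  case: eqP => [pi|/eqP pi]; last by rewrite node_code_flip // subrr expr0n mulr0.
  apply: ler_wpM2l; first exact: sqr_ge0.
  by have := hg (inord (p.2 %% r.+1)); rewrite /g inordK ?ltn_pmod // pi.
have -> : \sum_(p : 'I_n * 'I_n | p.1 == iu.1) h ^+ 2 * g (p.2 %% r.+1)%N =
    \sum_(i | i == iu.1) \sum_(j < n) h ^+ 2 * g (j %% r.+1)%N.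
  by rewrite pair_big /=; apply: eq_bigl => p; rewrite andbT.
rewrite big_pred1_eq -mulr_sumr -mulrA mulrCA; apply: ler_wpM2l; first exact: sqr_ge0.
rewrite (partition_big (fun j : 'I_n => inord (j %% r.+1) : 'I_r.+1) xpredT) //=.
apply: le_trans (_ : \sum_(u < r.+1) (n %/ r.+1).+1%:R * g u <= _).
  apply: ler_sum => u _.
  rewrite (eq_bigr (fun=> g u)); last by move=> j /eqP <-; rewrite inordK ?ltn_pmod.
  rewrite sumr_const -[leLHS]mulr_natl; apply: ler_wpM2r => //; rewrite ler_nat.
  apply: leq_trans (card_residue_class n u (ltn0Sn r)).
  apply: subset_leq_card; apply/fintype.subsetP => j; rewrite !inE /in_mem /= => /eqP <-.
  by rewrite inordK ?ltn_pmod.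
by rewrite -mulr_sumr mulrC; apply: ler_wpM2r; [|exact: geometric_half].
Qed.

End WaveNodes.

(** The length is of the order of [ln n], and at least 1 for small [n]; the
    base [q] absorbs any power of the frequency of the wave. *)
Lemma word_length (R : realType) (q n : nat) : (1 < q)%N -> (2 <= n)%N ->
  exists r : nat, [/\ (r.+1 <= n)%N, (q ^ r.+1 <= q * n)%N &
    ln (n%:R : R) <= 2 * r.+1%:R * ln q%:R].
Proof.
move=> q1 n2; have n0 : (0 < n)%N by lia.
pose t := trunc_log q n; have t1 := trunc_logP q1 n0; have t2 := trunc_log_ltn n q1.
have lq : 0 <= ln q%:R :> R by apply: ln_ge0; rewrite ler1n; lia.
have hln : ln (n%:R : R) <= t.+1%:R * ln q%:R.
  rewrite mulr_natl -lnXn ?ltr0n; last by lia.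
  rewrite ler_ln ?posrE ?exprn_gt0 ?ltr0n //; last by lia.
  by rewrite -natrX ler_nat ltnW.
exists (t.-1); case ht : t => [|s]; rewrite ht in hln; split=> /=.
- by lia.
- by rewrite expn1 leq_pmulr.
- by apply: le_trans hln _; apply: ler_wpM2r => //; lra.
- by apply: leq_trans t1; rewrite -/t ht; apply/ltnW/ltn_expl.
- by rewrite /t in ht; rewrite -ht; apply: leq_trans t1 _; rewrite leq_pmull //; lia.
- apply: le_trans hln _; apply: ler_wpM2r => //.
  by rewrite -natrM ler_nat; lia.
Qed.

(** At any smoothness the positions of the nodes are hard to estimate: a node
    has [ln n] bits, each of which is invisible at amplitude
    [(ln n / n)^(1/2)]. *)
Lemma minimax_lower_bound_smooth (R : realType) (a M : R) : 0 < a -> 0 < M ->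
  exists2 c : R, 0 < c & forall n, (2 <= n)%N ->
    ((c * (ln n%:R / n%:R))%:E <= minimax_risk n a M)%E.
Proof.
move=> a0 M0.
pose c0 := Num.min (1 / 2) (M / 4).
have c00 : 0 < c0 by rewrite lt_min; apply/andP; split; lra.
have c0h : c0 <= 1 / 2 by rewrite ge_min lexx.
have c0M : c0 <= M / 4 by rewrite ge_min lexx orbT.
pose m := Num.truncn a.
pose A : R := 2 * m.+1%:R * (m%:R + 8) ^+ m.+1.
have A0 : 0 < A by rewrite !mulr_gt0 ?ltr0n // exprn_gt0 // ltr_wpDl.
(* [q ^ k] dominates [k] times the square of the factor by which the wave,
   of frequency of the order of [256 ^ k], loses smoothness. *)
pose q : nat := (2 * 256 ^ (2 * m.+1))%N.
have q1 : (1 < q)%N.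
  have : (0 < 256 ^ (2 * m.+1))%N by rewrite expn_gt0.
  by rewrite /q; move: (256 ^ _)%N => X; lia.
have q0 : 0 < q%:R :> R by rewrite ltr0n ltnW.
have lq : 0 < ln q%:R :> R by rewrite ln_gt0 // ltr1n.
(* The first bound makes a bit undetectable, the second one keeps the wave in
   the Hoelder ball. *)
pose c := Num.min (c0 / 64) (M / (4 * A * q%:R)).
have cpos : 0 < c by rewrite lt_min !divr_gt0 // !mulr_gt0.
have cc0 : c <= c0 / 64 by rewrite ge_min lexx.
have cM : c * q%:R * A <= M / 4.
  have : c <= M / (4 * A * q%:R) by rewrite ge_min lexx orbT.
  rewrite ler_pdivlMr ?mulr_gt0 //; lra.
exists (c ^+ 2 / (128 * ln q%:R)); first by rewrite divr_gt0 ?exprn_gt0 // mulr_gt0.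
move=> n n2; have n0 : 0 < n%:R :> R by rewrite ltr0n; lia.
have [r [rn qr lnr]] := word_length R q1 n2.
set k := r.+1 in rn qr lnr.
have k0 : 0 < k%:R :> R by rewrite ltr0n.
pose s : R := k%:R / n%:R.
have s0 : 0 <= s by rewrite divr_ge0.
have s1 : s <= 1 by rewrite ler_pdivrMr // mul1r ler_nat.
pose h : R := c * Num.sqrt s.
have h0 : 0 <= h by rewrite mulr_ge0 ?sqrtr_ge0 // ltW.
have hh : h ^+ 2 = c ^+ 2 * s by rewrite exprMn sqr_sqrtr.
have hc : h <= c.
  by rewrite -[leRHS]mulr1 ler_pM2l // -sqrtr1 ler_wsqrtr.
pose w : R := wave_freq R r.
have p1 : 1 <= 256 ^+ k :> R by apply: exprn_ege1; lra.
have pi1 : 2 <= pi :> R by have := pi_ge2 R; lra.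
have w8 : w <= 8 * 256 ^+ k.
  rewrite /w /wave_freq -exprM mulnC exprM (_ : 16 ^+ 2 = 256 :> R); last by lra.
  apply: ler_wpM2r; first by lra.
  by have := pi_le4 R; lra.
have w1 : 1 <= w.
  rewrite /w /wave_freq -exprM mulnC exprM (_ : 16 ^+ 2 = 256 :> R); last by lra.
  by nra.
pose Y : R := (256 ^+ k) ^+ m.+1.
have Y0 : 0 <= Y by rewrite exprn_ge0 //; lra.
have hY : h * Y <= c * q%:R.
  have qq : k%:R * Y ^+ 2 <= q%:R * n%:R.
    apply: (@le_trans _ _ (q%:R ^+ k)); last by rewrite -natrX -natrM ler_nat.
    rewrite /q natrM natrX exprMn; apply: ler_pM; rewrite ?sqr_ge0 //.
      by rewrite -natrX ler_nat ltnW // ltn_expl.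
    have ex : (k * (m.+1 * 2) = 2 * m.+1 * k)%N by rewrite [LHS]mulnC [(m.+1 * 2)%N]mulnC.
    by rewrite /Y -!exprM ex.
  rewrite -(ler_pXn2r (n := 2)) ?nnegrE ?mulr_ge0 ?(ltW cpos) ?(ltW q0) //.
  rewrite exprMn hh exprMn -mulrA; apply: ler_wpM2l; first exact: sqr_ge0.
  rewrite /s mulrAC ler_pdivrMr //; apply: le_trans qq _.
  rewrite expr2 -!mulrA; apply: ler_wpM2l; first exact: ltW.
  by rewrite ler_peMl ?ler0n // ler1n ltnW.
have fH : holder_class a M (wave_graphon w c0 h).
  apply: wave_graphon_holder => //; [lra|lra|].
  rewrite -/m; apply: (@le_trans _ _ (h * Y * A)); last first.
    by apply: le_trans cM; apply: ler_wpM2r => //; exact: ltW.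
  rewrite -[leRHS]mulrA; apply: ler_wpM2l => //.
  rewrite /A [leRHS]mulrCA; apply: ler_wpM2l; first by rewrite mulr_ge0.
  rewrite /Y -exprMn; apply: lerXn2r; rewrite ?nnegrE ?mulr_ge0 ?addr_ge0 //; try lra.
  by have := ler0n R m; nra.
have f01 p : square p -> 0 <= wave_graphon w c0 h p <= 1.
  by have [H _ _] := fH; apply: H.
apply: minimax_risk_ge => that.
pose theta (z : {ffun 'I_n * 'I_r.+1 -> bool}) :=
  edge_prob (wave_graphon w c0 h) (wave_nodes R z).
have [z hz] : exists z, h ^+ 2 / 64 <= matrix_risk that (theta z).
  apply: (@assouad R n _ theta (@wave_cell n r) (c0 / 8)) => //.
  - by lra.
  - exact: sqr_ge0.
  - by move=> z i j; apply: (edge_prob01 f01); exact: wave_nodes_cube.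
  - move=> z p lp; rewrite /theta wave_edge_prob //.
    set x := cos _; have := cos_max x; have : `|x| <= 1 by apply: cos_max.
    rewrite ler_norml => /andP[x1 x2] _.
    have y1 := ler_wpM2l h0 x1; have y2 := ler_wpM2l h0 x2.
    split; [apply/andP; split|]; nra.
  - move=> z iu; apply: le_trans (wave_flip_dist _ _ _ _) _; rewrite hh.
    have sk : s * (n %/ k).+1%:R <= 2.
      rewrite -natr1 mulrDr mulr1; suff : s * (n %/ k)%:R <= 1 by lra.
      rewrite /s mulrAC ler_pdivrMr // mul1r -natrM ler_nat mulnC; exact: leq_trunc_div.
    have := ler_wpM2l (sqr_ge0 c) sk; rewrite mulrA => hs; nra.
  - move=> z p cp; exact: wave_flip_sep.
exists (wave_graphon w c0 h), (wave_nodes R z).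
split=> //; first exact: wave_nodes_cube.
apply: le_trans hz; rewrite hh /s.
rewrite mulrAC ler_pdivrMr ?mulr_gt0 //.
have -> : c ^+ 2 * (k%:R / n%:R) / 64 * (128 * ln q%:R) =
   c ^+ 2 * ((2 * k%:R * ln q%:R) / n%:R) by field; rewrite gt_eqF.
apply: ler_wpM2l; first exact: sqr_ge0.
by apply: ler_wpM2r => //; rewrite invr_ge0 ltW.
Qed.

Theorem theorem1p2 (R : realType) (alpha M : R) (halpha : 0 < alpha) (hM : 0 < M) :
  exists C : R, 0 < C /\
    forall n : nat, (2 <= n)%N ->
      ((C^-1 * rate alpha n)%:E <= minimax_risk n alpha M)%E /\
      (minimax_risk n alpha M <= (C * rate alpha n)%:E)%E.
Proof.
have [C C0 hC] := minimax_upper_bound halpha hM.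
have [c c0 hc] : exists2 c : R, 0 < c & forall n, (2 <= n)%N ->
    ((c * rate alpha n)%:E <= minimax_risk n alpha M)%E.
  have [a1|a1] := ltP alpha 1.
    by apply: minimax_lower_bound_rough; rewrite ?halpha.
  have [c c0 hc] := minimax_lower_bound_smooth halpha hM.
  by exists c => // n n2; rewrite /rate ltNge a1 /=; apply: hc.
exists (Num.max C c^-1); split=> [|n n2]; first by rewrite lt_max C0.
have r0 : 0 <= rate alpha n.
  rewrite /rate; case: ifP => _; first exact: powR_ge0.
  by rewrite divr_ge0 // ln_ge0 // ler1n; apply: ltnW.
split.
  apply: le_trans (hc n n2); rewrite lee_fin; apply: ler_wpM2r => //.
  by rewrite invf_ple ?posrE ?lt_max ?C0 // le_max lexx orbT.
apply: le_trans (hC n n2) _; rewrite lee_fin; apply: ler_wpM2r => //.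
by rewrite le_max lexx.
Qed.
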